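(* Let $\mathsf S$ be a full-dimensional simple polytope with the origin in its interior, and let $\mathsf P$ be an omnitruncation of $\mathsf S$ with normal fan $\Psi$. Then: (1) For $\epsilon>0$ small enough, the set $\{\operatorname{Tr}_\epsilon[\mathsf S,\mathsf F] : \emptyset\subsetneq\mathsf F\subsetneq\mathsf S\}$ of shallow proper $\epsilon$-truncations is a polytopal basis for the deformation space of $\mathsf P$. (2) The collection $\{\operatorname{DTr}[\mathsf S,\mathsf F] : \mathsf F\subsetneq\mathsf S\}$ of deep truncations (with $\mathsf F=\emptyset$ allowed) is a polytopal generating set for the deformation space of $\mathsf P$. (3) If $\mathsf S$ is a Delzant polytope, then the collection $\{\operatorname{Tr}_1[\mathsf S,\mathsf F] : \mathsf F\subsetneq\mathsf S\}$ of unit-depth truncations (with $\mathsf F=\emptyset$ allowed) is an integral polytopal generating set for the deformation space of $\mathsf P$. (4) If $\mathsf S$ is a primitive Delzant polytope, then the collection $\{\operatorname{DTr}[\mathsf S,\mathsf F] : \emptyset\subsetneq\mathsf F\subsetneq\mathsf S\}=\{\operatorname{Tr}_1[\mathsf S,\mathsf F] : \emptyset\subsetneq\mathsf F\subsetneq\mathsf S\}$ of deep proper truncations is a flat (all its elements are flat truncations), not necessarily integral, polytopal basis for the deformation space of $\mathsf P$.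
   Context: Conventions. Let $\Lambda$ be a lattice (by default $\mathbb Z^n\subset\mathbb R^n$) and $V=\Lambda\otimes\mathbb R$. Polytopes live in $V$; normal vectors live in $V^*$, which contains the dual lattice $\Lambda^*$ (for $\mathbb R^n$ everything is identified via the dot product). All polytopes are assumed to have rational facet normals. $h(\mathsf P,u)=\min_{x\in\mathsf P}u\cdot x$. For a nonempty face $\mathsf F$ of $\mathsf P$, its normal cone is $\{u : u\cdot x=h(\mathsf P,u)\ \forall x\in\mathsf F\}$; the normal fan $\Sigma(\mathsf P)$ is the collection of normal cones of nonempty faces. A fan coarsens another if each of its cones is a union of cones of the other. Face normals. For a facet $\mathsf G$ of $\mathsf S$, $u_{\mathsf G}\in\Lambda^*$ is its primitive inner normal; for a nonempty proper face $\mathsf F$, $u_{\mathsf F}=\sum_{\mathsf G\supseteq\mathsf F}u_{\mathsf G}$ over the facets containing $\mathsf F$. Truncations. For a nonempty proper face $\mathsf F$ and $\epsilon>0$, $\operatorname{Tr}_\epsilon[\mathsf S,\mathsf F]=\{x\in\mathsf S : u_{\mathsf F}\cdot x\ge h(\mathsf S,u_{\mathsf F})+\epsilon\}$. A vertex $y\notin\mathsf F$ is a neighbor of $\mathsf F$ if it is joined by an edge to a vertex of $\mathsf F$; $\delta_{\mathsf F}=\min\{u_{\mathsf F}\cdot y-h(\mathsf S,u_{\mathsf F}) : y\text{ a neighbor of }\mathsf F\}$. The truncation is shallow if $0<\epsilon<\delta_{\mathsf F}$; the deep truncation is $\operatorname{DTr}[\mathsf S,\mathsf F]=\operatorname{Tr}_{\delta_{\mathsf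 F}}[\mathsf S,\mathsf F]$; it is flat if it equals the convex hull of the vertices of $\mathsf S$ not in $\mathsf F$. By convention $\operatorname{Tr}_\epsilon[\mathsf S,\emptyset]=\operatorname{DTr}[\mathsf S,\emptyset]=\mathsf S$. Omnitruncation. List the nonempty proper faces as $\mathsf F_1,\dots,\mathsf F_m$ in an order extending inclusion (smaller faces first), let $\mathsf S_0=\mathsf S$, and for numbers $\epsilon_{\mathsf F}>0$ let $\mathsf S_i=\operatorname{Tr}_{\epsilon_{\mathsf F_i}}[\mathsf S_{i-1},\mathsf F_i\cap\mathsf S_{i-1}]$ (truncating in direction $u_{\mathsf F_i}$). If each truncation is shallow, $\mathsf S_m$ is an omnitruncation of $\mathsf S$. Its normal fan $\Psi$ is the barycentric subdivision of $\Sigma(\mathsf S)$: its cones are $\operatorname{Cone}(u_{\mathsf F_1},\dots,u_{\mathsf F_k})$ over chains $\mathsf F_1\subsetneq\dots\subsetneq\mathsf F_k$ of nonempty proper faces. Deformations. A deformation of $\mathsf P$ is a polytope whose normal fan coarsens $\Psi=\Sigma(\mathsf P)$. The deformation space of $\mathsf P$ is the vector space $\operatorname{PL}(\Psi)$ of functions on $V^*$ that are linear on each cone of $\Psi$. A collection of deformations of $\mathsf P$ is a polytopal generating set (resp. polytopal basis) if their support functions span (resp. form a basis of) $\operatorname{PL}(\Psi)$. The integral deformation space is the subgroup of functions in $\operatorname{PL}(\Psi)$ whose restriction to each cone is given by an element of $\Lambda$; a polytopal generating set is integral if its support functions generate this group over $\mathbb Z$. Smoothness. A full-dimensional polytope with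 vertices in $\Lambda$ is Delzant (smooth) if at every vertex the primitive lattice vectors along the incident edges form a basis of $\Lambda$. It is primitive Delzant if moreover the only lattice points on each edge are its endpoints. *)

(* Defs.v *)
From HB Require Import structures.
From mathcomp Require Export all_boot all_order all_algebra.
From mathcomp Require Export all_classical all_reals topology normedtype.

Set Implicit Arguments.
Unset Strict Implicit.
Unset Printing Implicit Defensive.
Import Order.TTheory GRing.Theory Num.Theory.
Import numFieldNormedType.Exports.

Local Open Scope classical_set_scope.
Local Open Scope ring_scope.

(* The space V and its dual V^* are both 'rV[R]_n, paired by the dot product;
   subsets of V (polytopes, faces) and of V^* (cones) are classical sets, and a
   fan is a set of sets. *)

Section Spans.
Variable R : realType.

Definition lspan (M : lmodType R) (A : set M) : set M :=
  [set f | exists k (g : 'I_k -> M) (c : 'I_k -> R),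
     (forall i, A (g i)) /\ f = \sum_(i < k) c i *: g i].

Definition lfree (M : lmodType R) (A : set M) :=
  forall k (g : 'I_k -> M) (c : 'I_k -> R),
    injective g -> (forall i, A (g i)) ->
    \sum_(i < k) c i *: g i = 0 -> forall i, c i = 0.

Definition zspan (M : zmodType) (A : set M) : set M :=
  [set f | exists k (g : 'I_k -> M) (c : 'I_k -> int),
     (forall i, A (g i)) /\ f = \sum_(i < k) g i *~ c i].

Definition zfree (M : zmodType) (A : set M) :=
  forall k (g : 'I_k -> M) (c : 'I_k -> int),
    injective g -> (forall i, A (g i)) ->
    \sum_(i < k) g i *~ c i = 0 -> forall i, c i = 0.

End Spans.

Section Polytopes.
Variables (R : realType) (n : nat).
Local Notation V := 'rV[R]_n.
Implicit Types (L P Q S F G : set V) (u v w x y : V).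

Definition dot u x : R := \sum_(i < n) u 0 i * x 0 i.

Definition lattice L :=
  exists2 B : 'M[R]_n, B \in unitmx & L = zspan [set row i B | i in [set: 'I_n]].

Definition dual_lattice L : set V :=
  [set u | forall x, L x -> dot u x \is a Num.int].

Definition primitive L w :=
  [/\ L w, w <> 0 & forall v (k : nat), L v -> w = v *+ k -> k = 1%N].

Definition hull (A : set V) : set V :=
  [set x | exists k (p : 'I_k -> V) (c : 'I_k -> R),
     [/\ forall i, A (p i), forall i, 0 <= c i,
         \sum_(i < k) c i = 1 & x = \sum_(i < k) c i *: p i]].

(* On a nonempty polytope the infimum is attained. *)
Definition supp P : V -> R := fun u => inf [set dot u x | x in P].

Definition exposed P u : set V :=
  [set x | P x /\ forall y, P y -> dot u x <= dot u y].

Definition face P F := F = set0 \/ exists u, F = exposed P u.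

Definition proper_face P F := face P F /\ F `<` P.

Definition nonempty_proper_face P F := proper_face P F /\ F !=set0.

Definition facet P G := nonempty_proper_face P G /\
  forall F, proper_face P F -> G `<=` F -> F = G.

Definition vertex P x := face P [set x].

Definition edge P x y := x <> y /\ face P (hull [set x; y]).

(* The last clause is rationality of the facet normals with respect to L; for a
   full-dimensional P the vectors exposing a facet are its nonzero inner
   normals. *)
Definition polytope L P :=
  [/\ exists A, finite_set A /\ P = hull A, P !=set0 &
      forall G, facet P G -> exists2 u, dual_lattice L u & G = exposed P u].

Definition full_dim P := interior P !=set0.

Definition simple P :=
  forall x, vertex P x -> ([set G | facet P G /\ G x] #= `I_n)%card.

Definition ncone P F : set V :=
  [set u | forall x, F x -> dot u x = supp P u].

Definition nfan P : set (set V) :=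
  [set ncone P F | F in [set F | face P F /\ F !=set0]].

Definition coarsens (Sigma Psi : set (set V)) :=
  forall sigma, Sigma sigma ->
  exists2 C, C `<=` Psi & sigma = \bigcup_(tau in C) tau.

Definition facet_normal L S G : V :=
  xget 0 [set u | ncone S G u /\ primitive (dual_lattice L) u].

Definition face_normal L S F : V :=
  \sum_(G \in [set G | facet S G /\ F `<=` G]) facet_normal L S G.

(* Truncation of Q in an explicit direction u: the steps of an omnitruncation
   use directions coming from the original polytope S. *)
Definition trunc Q u (eps : R) : set V :=
  Q `&` [set x | supp Q u + eps <= dot u x].

Definition neighbor Q F y :=
  [/\ vertex Q y, ~ F y & exists x, [/\ vertex Q x, F x & edge Q x y]].

Definition depth Q F u : R :=
  inf [set dot u y - supp Q u | y in neighbor Q F].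

Definition shallow Q F u (eps : R) := 0 < eps < depth Q F u.

Definition Tr L S F (eps : R) : set V :=
  if `[< F = set0 >] then S else trunc S (face_normal L S F) eps.

Definition delta L S F : R := depth S F (face_normal L S F).

Definition DTr L S F : set V := Tr L S F (delta L S F).

Definition flat L S F := DTr L S F = hull [set x | vertex S x /\ ~ F x].

(* S_i, where fs lists the faces F_1, ..., F_m. *)
Definition omni L S (fs : seq (set V)) (eps : set V -> R) (i : nat) : set V :=
  foldl (fun Q F => trunc Q (face_normal L S F) (eps F)) S (take i fs).

Definition face_listing S (fs : seq (set V)) :=
  [/\ uniq fs, forall F, F \in fs <-> nonempty_proper_face S F &
      forall i j, (i < size fs)%N -> (j < size fs)%N ->
        nth set0 fs i `<=` nth set0 fs j -> (i <= j)%N].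

Definition omnitruncation L S P :=
  exists (fs : seq (set V)) (eps : set V -> R),
  [/\ face_listing S fs,
      forall i, (i < size fs)%N ->
        let F := nth set0 fs i in let Q := omni L S fs eps i in
        shallow Q (F `&` Q) (face_normal L S F) (eps F) &
      P = omni L S fs eps (size fs)].

Definition deformation L P Q := polytope L Q /\ coarsens (nfan Q) (nfan P).

Definition PL (Psi : set (set V)) : set (V -> R) :=
  [set f | forall sigma, Psi sigma ->
     exists x, forall u, sigma u -> f u = dot u x].

Definition PLint L (Psi : set (set V)) : set (V -> R) :=
  [set f | forall sigma, Psi sigma ->
     exists2 x, L x & forall u, sigma u -> f u = dot u x].

Definition generating_set L P (C : set (set V)) :=
  (forall Q, C Q -> deformation L P Q) /\ lspan (supp @` C) = PL (nfan P).

Definition basis L P (C : set (set V)) :=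
  generating_set L P C /\ lfree (supp @` C).

Definition integral_generating_set L P (C : set (set V)) :=
  generating_set L P C /\ zspan (supp @` C) = PLint L (nfan P).

Definition edge_vectors L S x : set V :=
  [set w | primitive L w /\
     exists y (t : R), [/\ edge S x y, 0 < t & y - x = t *: w]].

Definition delzant L S :=
  [/\ polytope L S, full_dim S, vertex S `<=` L &
      forall x, vertex S x ->
        zspan (edge_vectors L S x) = L /\ zfree (edge_vectors L S x)].

Definition primitive_delzant L S := delzant L S /\
  forall x y, edge S x y -> L `&` hull [set x; y] = [set x; y].

End Polytopes.

(* Main.v *)
(* Let [u_F] be the sum of the facet normals of the facets containing [F]. A
   shallow truncation of a simple polytope replaces each vertex of the cut face
   by one vertex inside every edge leaving the face, whose normal cone is the
   old one with one generator replaced by the cutting direction. Inductively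
   every normal cone of the omnitruncation is generated by [u_F] for the faces
   [F] of a full flag of [S]. So a piecewise linear function on the fan is
   determined by its values at the [u_F], and a polytope is a deformation as
   soon as the normals of each flag have a common minimizer on it. For [0 < e
   <= delta_F] this holds for [Tr_e[S,F]], with minimizer [x] or [x + e d_j]
   next to the vertex [x] of the flag, and the support function takes the value
   [h_S(u_F') + e [F' <= F]] at [u_F']. The matrix [[F' <= F]] is
   unitriangular, which yields (2) and (3). For (1) and (4) one has to invert
   [e [F' <= F]] plus the matrix with all columns equal to [h_S(u_F')]; as
   [h_S(u_F')] is the sum of [h_S(u_G)] over the facets [G] containing [F'],
   this is possible iff [e + \sum_G h_S(u_G) <> 0]. In the Delzant case the
   [h_S(u_G)] are negative integers and there are at least two facets, so [e =
   1] is allowed. *)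
From mathcomp Require Import fingroup perm ring lra.
Require Import Defs.

Set Implicit Arguments.
Unset Strict Implicit.
Unset Printing Implicit Defensive.
Import Order.TTheory GRing.Theory Num.Theory.
Import numFieldNormedType.Exports.

Local Open Scope classical_set_scope.
Local Open Scope ring_scope.

(** * Dot product and dual bases *)
Section DotProduct.
Variables (R : realType) (n : nat).
Implicit Types (u v w x y : 'rV[R]_n) (a : R).

(** The face normals come from [S], but the shallowness of each step is measured on an intermediate
    polytope. The invariant therefore has to remember, for every vertex of a stage, a vertex of [S]
    together with an ordering of the facets through it. Since smaller faces are cut first, the
    replaced generators always form a tail of that ordering. At depth [delta] a truncation need not
    be simple and its vertices are not controlled; for this reason the deformation criterion asks
    only for one common minimizer per flag, which can be named in terms of [S] alone. Throughout,
    faces are sets of minimizers of linear functionals: smaller faces are reached by perturbing the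
    functional, and normal cones of cuts by a Lagrange multiplier. *)

Lemma dotC u x : dot u x = dot x u.
Proof. by apply: eq_bigr => i _; rewrite mulrC. Qed.

Lemma dotDl u v x : dot (u + v) x = dot u x + dot v x.
Proof. by rewrite -big_split; apply: eq_bigr => i _; rewrite mxE mulrDl. Qed.

Lemma dotDr u x y : dot u (x + y) = dot u x + dot u y.
Proof. by rewrite dotC dotDl !(dotC _ u). Qed.

Lemma dotZl a u x : dot (a *: u) x = a * dot u x.
Proof. by rewrite mulr_sumr; apply: eq_bigr => i _; rewrite mxE mulrA. Qed.

Lemma dotZr a u x : dot u (a *: x) = a * dot u x.
Proof. by rewrite dotC dotZl dotC. Qed.

Lemma dot0l x : dot 0 x = 0.
Proof. by apply: big1 => i _; rewrite mxE mul0r. Qed.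

Lemma dot0r u : dot u 0 = 0.
Proof. by rewrite dotC dot0l. Qed.

Lemma dotNl u x : dot (- u) x = - dot u x.
Proof. by rewrite -scaleN1r dotZl mulN1r. Qed.

Lemma dotNr u x : dot u (- x) = - dot u x.
Proof. by rewrite dotC dotNl dotC. Qed.

Lemma dotBl u v x : dot (u - v) x = dot u x - dot v x.
Proof. by rewrite dotDl dotNl. Qed.

Lemma dotBr u x y : dot u (x - y) = dot u x - dot u y.
Proof. by rewrite dotDr dotNr. Qed.

Definition dotE := (dotBl, dotBr, dotDl, dotDr, dotNl, dotNr, dotZl, dotZr).

Lemma dot_suml I (r : seq I) (p : pred I) (f : I -> 'rV[R]_n) x :
  dot (\sum_(i <- r | p i) f i) x = \sum_(i <- r | p i) dot (f i) x.
Proof.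
apply: (big_ind2 (fun u a => dot u x = a)) => [|u a v b <- <-|//].
- exact: dot0l.
- exact: dotDl.
Qed.

Lemma dot_sumr I (r : seq I) (p : pred I) (f : I -> 'rV[R]_n) u :
  dot u (\sum_(i <- r | p i) f i) = \sum_(i <- r | p i) dot u (f i).
Proof. by rewrite dotC dot_suml; apply: eq_bigr => i _; rewrite dotC. Qed.

Lemma dot_ge0 u : 0 <= dot u u.
Proof. by apply: sumr_ge0 => i _; rewrite -expr2 sqr_ge0. Qed.

Lemma dot_eq0 u : dot u u = 0 -> u = 0.
Proof.
move=> /eqP; rewrite psumr_eq0 => [/allP u0|i _];
  last by rewrite -expr2 sqr_ge0.
apply/rowP => i; rewrite mxE; apply/eqP.
by have := u0 i (mem_index_enum i); rewrite mulf_eq0 orbb.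
Qed.

Lemma dot_gt0 u : u != 0 -> 0 < dot u u.
Proof.
move=> u0; rewrite lt_neqAle dot_ge0 andbT eq_sym.
by apply: contra u0 => /eqP/dot_eq0 ->.
Qed.

Definition dual_bases (b d : 'I_n -> 'rV[R]_n) :=
  forall i j, dot (b i) (d j) = (i == j)%:R.

Lemma dual_bases_sym b d : dual_bases b d -> dual_bases d b.
Proof. by move=> bd i j; rewrite dotC bd eq_sym. Qed.

Lemma dual_bases_mx b d : dual_bases b d ->
  (\matrix_i b i) *m (\matrix_i d i)^T = 1%:M.
Proof.
move=> bd; apply/matrixP => i j; rewrite !mxE -bd.
by apply: eq_bigr => k _; rewrite !mxE.
Qed.

Lemma dual_expand b d v : dual_bases b d -> v = \sum_i dot v (d i) *: b i.
Proof.
move=> /dual_bases_mx /mulmx1C bd.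
rewrite -[LHS]mulmx1 -bd mulmxA [in RHS](eq_bigr
  (fun i => (v *m (\matrix_i d i)^T) 0 i *: row i (\matrix_i b i))).
  by rewrite -mulmx_sum_row.
move=> i _; rewrite rowK; congr (_ *: _); rewrite mxE.
by apply: eq_bigr => k _; rewrite !mxE.
Qed.

Lemma dual_inj b d x y : dual_bases b d ->
  (forall i, dot (b i) x = dot (b i) y) -> x = y.
Proof.
move=> /dual_bases_sym db xy; rewrite (dual_expand x db) (dual_expand y db).
by apply: eq_bigr => i _; rewrite !(dotC _ (b i)) xy.
Qed.

(** [C] is a left inverse of the square matrix [B], hence a right inverse; spanning alone thus
    yields the dual family. *)
Lemma dual_bases_exists b :
  (forall v, exists c : 'I_n -> R, v = \sum_i c i *: b i) ->
  exists d, dual_bases b d.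
Proof.
move=> /choice[c cP]; pose B := \matrix_i b i.
pose C := \matrix_(i, j) c (delta_mx 0 i) j.
have CB : C *m B = 1%:M.
  apply/row_matrixP => i; rewrite row_mul mulmx_sum_row row1 [RHS]cP.
  by apply: eq_bigr => j _; rewrite rowK !mxE.
exists (fun j => row j C^T) => i j; have /matrixP/(_ i j) := mulmx1C CB.
by rewrite !mxE => <-; apply: eq_bigr => k _; rewrite !mxE.
Qed.

(** Induction on the number of generators. A separator [x] for the other generators either works for
    the last one, [l], or has [dot l x < 0]; in the second case all vectors are projected along [l]
    onto the hyperplane orthogonal to [x]. *)
Lemma farkas m (a : 'I_m -> 'rV[R]_n) b :
  (exists2 c, forall i, 0 <= c i & b = \sum_i c i *: a i) \/
  (exists2 x, forall i, 0 <= dot (a i) x & dot b x < 0).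
Proof.
elim: m a b => [|m IH] a b.
  have [->|b0] := eqVneq b 0; [left|right].
    by exists (fun=> 0) => //; rewrite big_ord0.
  by exists (- b) => [[]//|]; rewrite dotNr oppr_lt0 dot_gt0.
pose a0 i := a (widen_ord (leqnSn m) i); pose l := a ord_max.
have wE i : widen_ord (leqnSn m) i = lift ord_max i.
  by apply: val_inj; rewrite /= /bump leqNgt ltn_ord.
have ext c d : (forall i, 0 <= c i) -> 0 <= d ->
    exists2 c', forall i, 0 <= c' i &
      \sum_i c i *: a0 i + d *: l = \sum_(i < m.+1) c' i *: a i.
  move=> c0 d0; exists (fun i => if unlift ord_max i is Some j then c j else d).
    by move=> i; case: unlift.
  rewrite big_ord_recr/= unlift_none; congr (_ + _).
  by apply: eq_bigr => i _; rewrite /a0 wE liftK.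
have split_a x : (forall i, 0 <= dot (a0 i) x) -> 0 <= dot l x ->
    forall i, 0 <= dot (a i) x.
  move=> a0x lx i; case: (unliftP ord_max i) => [j|] ->//.
  by rewrite -wE; exact: a0x.
have [[c c0 ->]|[x ax bx]] := IH a0 b.
  left; have [c' c'0 E] := ext c 0 c0 (lexx _); exists c' => //.
  by rewrite -E scale0r addr0.
have [lx|lx] := leP 0 (dot l x).
  by right; exists x => //; exact: split_a.
have lx0 : dot l x != 0 by rewrite lt_eqF.
pose q v := dot v x / dot l x.
have [[c c0 E]|[y ay bY]] := IH (fun i => a0 i - q (a0 i) *: l) (b - q b *: l).
  (* [d] collects the multiples of [l] removed by the projection; the signs of [dot b x], [dot l x]
     and [dot (a0 i) x] make it nonnegative. *)
  left; pose d := q b - \sum_i c i * q (a0 i).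
  have [|c' c'0 E'] := ext c d c0.
    rewrite /d /q; have -> : \sum_i c i * (dot (a0 i) x / dot l x) =
        (\sum_i c i * dot (a0 i) x) / dot l x.
      by rewrite mulr_suml; apply: eq_bigr => i _; rewrite mulrA.
    rewrite -mulrBl -mulrNN mulr_ge0// -?invrN ?invr_ge0 ?oppr_ge0 ?(ltW lx)//.
    rewrite subr_le0; apply: (le_trans (ltW bx)); apply: sumr_ge0 => i _.
    by rewrite mulr_ge0.
  exists c' => //; rewrite -E' /d scalerBl addrCA.
  rewrite -[b in LHS](subrK (q b *: l)) E addrC; congr (_ + _).
  rewrite scaler_suml -sumrB; apply: eq_bigr => i _.
  by rewrite scalerBr scalerA.
have swap (p r : R) : p / dot l x * r = r / dot l x * p.
  by rewrite mulrAC [RHS]mulrAC (mulrC p).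
(* This multiple of [x] makes the separator orthogonal to [l]; its value on [a0 i] is then that of
   [y] on the projected vector. *)
right; exists (y - (dot l y / dot l x) *: x).
  apply: split_a => [i|]; last by rewrite !dotE divfK// subrr.
  by have := ay i; rewrite !dotE /q swap.
by move: bY; rewrite !dotE /q swap.
Qed.

End DotProduct.

(** * Convex hulls and exposed faces *)
Section Hulls.
Variables (R : realType) (n : nat).
Local Notation V := 'rV[R]_n.
Implicit Types (u v w x y z : V) (A B C Q : set V) (s : seq V).

Lemma seq_min (T : eqType) (f : T -> R) (s : seq T) : s != [::] ->
  exists2 a, a \in s & forall b, b \in s -> f a <= f b.
Proof.
elim: s => // a [|c s] IH _.
  by exists a; rewrite ?mem_head// => b; rewrite inE => /eqP ->.
have [//|m ms mP] := IH.
have [am|ma] := leP (f a) (f m).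
  exists a; rewrite ?mem_head// => b; rewrite inE => /predU1P[->//|/mP].
  exact: le_trans.
exists m => [|b]; first by rewrite in_cons ms orbT.
by rewrite inE => /predU1P[->|/mP//]; exact: ltW.
Qed.

(** The source of small parameters: finitely many strict inequalities survive a small
    perturbation. *)
Lemma seq_small (T : eqType) (f g : T -> R) (s : seq T) :
  exists2 e, 0 < e & forall a, a \in s -> 0 < f a -> e * g a < f a.
Proof.
elim: s => [|a s [e e0 eP]]; first by exists 1.
have [fa|fa] := ltP 0 (f a); last first.
  exists e => // b; rewrite inE => /predU1P[->|/eP//].
  by rewrite ltNge fa.
pose e' := f a / (1 + `|g a|).
have d0 : 0 < 1 + `|g a| by rewrite ltr_pwDl.
have e'0 : 0 < e' by rewrite divr_gt0.
exists (Num.min e e') => [|b]; first by rewrite lt_min e0.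
have ming (c : R) : Num.min e e' * c <= e * `|c| /\ Num.min e e' * c <= e' *
  `|c|.
  have m0 : 0 <= Num.min e e' by rewrite le_min !ltW.
  have h : Num.min e e' * c <= Num.min e e' * `|c|
    by rewrite ler_wpM2l ?ler_norm.
  by split; apply: (le_trans h); rewrite ler_wpM2r// ge_min lexx ?orbT.
rewrite inE => /predU1P[->{b} _|bs fb].
  have [_ h] := ming (g a); apply: (le_lt_trans h).
  rewrite /e' -mulrA gtr_pMr// mulrC ltr_pdivrMr// mul1r.
  by rewrite ltrDr ltr01.
have [g0|g0] := leP 0 (g b).
  have [h _] := ming (g b); apply: (le_lt_trans h).
  by rewrite ger0_norm// eP.
apply: le_lt_trans fb; rewrite nmulr_lle0// le_min !ltW//.
Qed.

Lemma sub_hull A : A `<=` hull A.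
Proof.
move=> x Ax; exists 1%N, (fun=> x), (fun=> 1).
by rewrite !big_ord1 scale1r; split.
Qed.

Lemma hull_fin A (I : finType) (P : pred I) (p : I -> V) (c : I -> R) :
  (forall i, P i -> A (p i)) -> (forall i, P i -> 0 <= c i) ->
  \sum_(i | P i) c i = 1 -> hull A (\sum_(i | P i) c i *: p i).
Proof.
move=> pA c0 c1; pose e (i : 'I_#|P|) := enum_val i.
exists #|P|, (p \o e), (c \o e); split => [i|i||].
- exact/pA/enum_valP.
- exact/c0/enum_valP.
- by rewrite -c1; symmetry; exact: (big_enum_val (A := P)).
- exact: (big_enum_val (A := P)).
Qed.

Definition convex C := forall x y (t : R), C x -> C y -> 0 <= t <= 1 ->
  C (x + t *: (y - x)).

Lemma convex_hull A : convex (hull A).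
Proof.
move=> _ _ t [k [p [c [pA c0 c1 ->]]]] [l [q [d [qA d0 d1 ->]]]] /andP[t0 t1].
pose f (i : 'I_k + 'I_l) := match i with inl i => p i | inr i => q i end.
pose g (i : 'I_k + 'I_l) :=
  match i with inl i => (1 - t) * c i | inr i => t * d i end.
have -> : \sum_(i < k) c i *: p i + t *: (\sum_(i < l) d i *: q i -
    \sum_(i < k) c i *: p i) = \sum_i g i *: f i.
  have Z m a (b : 'I_m -> R) (r : 'I_m -> V) :
      \sum_(i < m) (a * b i) *: r i = a *: \sum_(i < m) b i *: r i.
    by rewrite scaler_sumr; apply: eq_bigr => i _; rewrite scalerA.
  rewrite big_sumType/= !Z scalerBr scalerBl scale1r.
  by rewrite addrA addrAC.
apply: hull_fin => [[i|i] _|[i|i] _|]//=.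
- by rewrite mulr_ge0// subr_ge0.
- by rewrite mulr_ge0.
- by rewrite big_sumType/= -!mulr_sumr c1 d1; ring.
Qed.

Lemma hull_least A C : convex C -> A `<=` C -> hull A `<=` C.
Proof.
move=> Cc AC _ [k [p [c [pA c0 c1 ->]]]].
(* Dropping a point destroys total weight 1, so the induction runs over arbitrary positive weights
   and normalizes. *)
suff H : 0 < \sum_(i < k) c i ->
    C ((\sum_(i < k) c i)^-1 *: \sum_(i < k) c i *: p i).
  by rewrite c1 invr1 scale1r in H; exact: H.
elim: k p c pA c0 {c1} => [|k IH] p c pA c0; first by rewrite big_ord0 ltxx.
rewrite !big_ord_recr/=; set S := \sum_(i < k) _; set X := \sum_(i < k) _ *: _.
have S0 : 0 <= S by apply: sumr_ge0.
move=> Sc; have [S_eq0|S_neq0] := eqVneq S 0.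
  have -> : X = 0.
    apply: big1 => i _; move/eqP: S_eq0; rewrite psumr_eq0//.
    by move=> /allP/(_ i (mem_index_enum i))/eqP ->; rewrite scale0r.
  rewrite S_eq0 add0r in Sc *.
  by rewrite add0r scalerA mulVf ?gt_eqF// scale1r; exact/AC.
have S_gt0 : 0 < S by rewrite lt_neqAle eq_sym S_neq0.
have CX := IH (fun i => p (widen_ord (leqnSn k) i))
  (fun i => c (widen_ord (leqnSn k) i)) (fun i => pA _) (fun i => c0 _) S_gt0.
have t01 : 0 <= c ord_max / (S + c ord_max) <= 1.
  by rewrite ler_pdivrMr// mul1r lerDr S0 divr_ge0// addr_ge0.
have := Cc _ _ _ CX (AC _ (pA ord_max)) t01; rewrite -/S -/X.
have Sc0 : S + c ord_max != 0 by rewrite gt_eqF.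
congr C; rewrite [RHS]scalerDr scalerBr !scalerA.
rewrite [_ / _ *: p _ - _]addrC addrA -scalerBl [in RHS](mulrC _ (c _)).
congr (_ *: _ + _).
by field; rewrite S_neq0 Sc0.
Qed.

Lemma convexI C D : convex C -> convex D -> convex (C `&` D).
Proof. by move=> Cc Dc x y t [? ?] [? ?] ?; split; [apply: Cc|apply: Dc]. Qed.

Lemma convex_halfspace u r : convex [set x | r <= dot u x].
Proof.
move=> x y t /= hx hy /andP[t0 t1]; rewrite !dotE.
have -> : dot u x + t * (dot u y - dot u x) =
  (1 - t) * dot u x + t * dot u y by ring.
have -> : r = (1 - t) * r + t * r by ring.
by rewrite lerD// ler_wpM2l// subr_ge0.
Qed.

Lemma hull_dot_ge A u r x :
  (forall a, A a -> r <= dot u a) -> hull A x -> r <= dot u x.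
Proof. by move=> H; apply: (hull_least (@convex_halfspace u r)). Qed.

Lemma hull_dot_eq A u r x :
  (forall a, A a -> dot u a = r) -> hull A x -> dot u x = r.
Proof.
move=> H Ax; apply/le_anti/andP; split.
  rewrite -lerN2 -dotNl; apply: hull_dot_ge Ax => a /H <-.
  by rewrite dotNl.
by apply: hull_dot_ge Ax => a /H <-.
Qed.

Lemma hull2 x y z : hull [set x; y] z <->
  exists2 t, 0 <= t <= 1 & z = x + t *: (y - x).
Proof.
split=> [|[t t01 ->]]; last first.
  by apply: convex_hull => //; apply: sub_hull; [left|right].
apply: (@hull_least _ [set z | exists2 t, 0 <= t <= 1 & z = x + t *: (y - x)]).
  move=> _ _ r [t /andP[t0 t1] ->] [t' /andP[t'0 t'1] ->] /andP[r0 r1].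
  exists (t + r * (t' - t)).
    by apply/andP; split; nra.
  rewrite opprD addrACA subrr add0r -scalerBl scalerA.
  by rewrite scalerDl addrA.
move=> _ [->|->] /=.
- by exists 0; rewrite ?lexx ?ler01// scale0r addr0.
- by exists 1; rewrite ?lexx ?ler01// scale1r addrC subrK.
Qed.

Lemma exposed_sub Q u : exposed Q u `<=` Q. Proof. by move=> x []. Qed.

Lemma convex_exposed Q u : convex Q -> convex (exposed Q u).
Proof.
move=> Qc x y t [Qx xP] [Qy yP] t01; split; first exact: Qc.
move=> z Qz; have xy : dot u y = dot u x by apply/le_anti; rewrite xP ?yP.
by rewrite !dotE xy subrr mulr0 addr0; exact: xP.
Qed.

Lemma exposed_eq Q u x y : exposed Q u x -> exposed Q u y -> dot u x = dot u y.
Proof. by move=> [Qx xP] [Qy yP]; apply/le_anti; rewrite xP ?yP. Qed.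

Lemma exposedE Q u x y : exposed Q u x -> Q y -> dot u y = dot u x ->
  exposed Q u y.
Proof. by move=> [Qx xP] Qy yx; split=> // z /xP; rewrite yx. Qed.

Lemma exposedS Q T u x : T `<=` Q -> exposed Q u x -> T x -> exposed T u x.
Proof. by move=> TQ [_ xP] Tx; split=> // y /TQ /xP. Qed.

Lemma exposed0 Q : exposed Q 0 = Q.
Proof.
by apply/seteqP; split=> [x []//|x Qx]; split=> // y _; rewrite !dot0l.
Qed.

(** With a common minimizer the minimum of the sum is the sum of the minima, so no minimizer of the
    sum can exceed either one. *)
Lemma exposedD Q u v x : exposed Q u x -> exposed Q v x ->
  exposed Q (u + v) `<=` exposed Q u.
Proof.
move=> ux vx y [Qy yP]; apply: (exposedE ux) => //.
have := yP x (exposed_sub ux); rewrite !dotE.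
move: ux vx => [_ /(_ _ Qy) ux] [_ /(_ _ Qy) vx] h.
by apply/le_anti; rewrite ux andbT; lra.
Qed.

Lemma exposed_addr Q u v x : exposed Q u x -> exposed Q v x ->
  exposed Q (u + v) x.
Proof.
by move=> [Qx ux] [_ vx]; split=> // y Qy; rewrite !dotE lerD ?ux ?vx.
Qed.

Lemma exposedZ Q u x a : 0 <= a -> exposed Q u x -> exposed Q (a *: u) x.
Proof. by move=> a0 [Qx ux]; split=> // y Qy; rewrite !dotE ler_wpM2l ?ux. Qed.

Lemma exposedZ_eq Q u a : 0 < a -> exposed Q (a *: u) = exposed Q u.
Proof.
move=> a0; apply/seteqP; split=> x; last exact/exposedZ/ltW.
move=> h; rewrite -[u](@scalerK _ _ a) ?gt_eqF//.
by apply: exposedZ => //; rewrite invr_ge0 ltW.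
Qed.

Lemma exposed_sum Q (I : Type) (r : seq I) (P : pred I) (f : I -> V) x :
  Q x -> (forall i, P i -> exposed Q (f i) x) ->
  exposed Q (\sum_(i <- r | P i) f i) x.
Proof.
move=> Qx fx; apply: (big_ind (fun u => exposed Q u x)) => //.
- by rewrite exposed0.
- by move=> u v; exact: exposed_addr.
Qed.

Lemma supp_exposed Q u x : exposed Q u x -> supp Q u = dot u x.
Proof.
move=> [Qx xP]; apply/le_anti; apply/andP; split.
  by apply: ge_inf; [exists (dot u x) => _ [y Qy <-]; exact: xP|exists x].
apply: lb_le_inf; first by exists (dot u x), x.
by move=> _ [y Qy <-]; exact: xP.
Qed.

End Hulls.

(** * Vertices and separation *)
Section Faces.
Variables (R : realType) (n : nat).
Local Notation V := 'rV[R]_n.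
Implicit Types (u v w x y z : V) (A B C Q : set V).

Lemma vertexP Q z : vertex Q z <-> exists u, exposed Q u = [set z].
Proof.
split=> [[|[u ->]]|[u uz]]; last by right; exists u.
  by move=> /seteqP[/(_ z erefl)].
by exists u.
Qed.

Lemma vertex_in Q z : vertex Q z -> Q z.
Proof. by move=> /vertexP[u uz]; have [] : exposed Q u z by rewrite uz. Qed.

Section FiniteHull.
Variable s : seq V.
Local Notation Q := (hull [set` s]).

(** Lexicographic minimization is realized by a single functional: a small multiple of [v] cannot
    overturn strict inequalities of [w] between the generators, and it breaks the ties. *)
Lemma exposed_exposed w v : s != [::] ->
  exists e a, [/\ 0 < e, a \in s, exposed (exposed Q w) v a &
    exposed Q (w + e *: v) = exposed (exposed Q w) v].
Proof.
move=> s0; have [m ms mP] := seq_min (dot w) s0.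
pose E := [seq a <- s | dot w a == dot w m].
have Em : m \in E by rewrite mem_filter eqxx ms.
have [|a0] := @seq_min _ _ (dot v) E; first by case: (E) Em.
rewrite mem_filter => /andP[/eqP a0m a0s] a0P.
have wa0 a : a \in s -> dot w a0 <= dot w a by rewrite a0m; exact: mP.
have [e e0 eP] := seq_small (fun a => dot w (a - a0))
  (fun a => 2 * dot v (a0 - a)) s.
(* Equivalently, [w + (2 * e) *: v] is nonnegative on [x - a0]. Halving the perturbation leaves
   slack, so that a minimizer of [w + e *: v] also minimizes [w]. *)
have key x : Q x -> dot w (x - a0) <= 2 * dot (w + e *: v) (x - a0).
  move=> Qx; pose u' := w + (2 * e) *: v.
  suff : dot u' a0 <= dot u' x by rewrite /u' !dotE; lra.
  apply: hull_dot_ge Qx => a /= sa; rewrite /u' !dotE.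
  have := wa0 a sa; rewrite le_eqVlt => /predU1P[aE|lt_a].
    suff : e * dot v a0 <= e * dot v a by lra.
    by rewrite ler_wpM2l ?(ltW e0)// a0P// mem_filter sa -aE a0m eqxx.
  have := eP a sa; rewrite !dotE subr_gt0 => /(_ lt_a); lra.
have ex0 : exposed Q w a0.
  split; first exact: sub_hull.
  by move=> y; apply: hull_dot_ge; exact: wa0.
have v_ge y : exposed Q w y -> dot v a0 <= dot v y.
  move=> wy; have := key y (exposed_sub wy).
  rewrite !dotE (exposed_eq wy ex0) subrr => h.
  rewrite -subr_ge0 -(pmulr_rge0 _ e0) mulrBr; lra.
have ex1 : exposed (exposed Q w) v a0 by split.
have ex2 : exposed Q (w + e *: v) a0.
  split=> [|y Qy]; first exact: sub_hull.
  have := key y Qy; have := ex0.2 y Qy; rewrite !dotE; lra.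
exists e, a0; split=> //; apply/seteqP; split=> x.
  move=> ex; have Qx := exposed_sub ex.
  have := key x Qx; rewrite (dotBr (w + _)) (exposed_eq ex ex2) subrr mulr0.
  rewrite dotBr subr_le0 => h.
  have wx : dot w x = dot w a0 by apply/le_anti; rewrite h ex0.2.
  apply: (exposedE ex1); first exact: (exposedE ex0).
  have := exposed_eq ex ex2; rewrite !dotE wx => /addrI.
  by apply: mulfI; rewrite gt_eqF.
move=> ex; apply: (exposedE ex2); first by case: ex => -[].
by rewrite !dotE (exposed_eq ex ex1) (exposed_eq (exposed_sub ex) ex0).
Qed.

Lemma exposed_seq w : s != [::] -> exists2 a, a \in s & exposed Q w a.
Proof.
by move=> s0; have [e [a [_ sa [ea _] _]]] := exposed_exposed w 0 s0; exists a.
Qed.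

(** On the face exposed by [u] the maximum of [v] is attained at a generator, where by hypothesis
    [v] takes its minimum over [Q]. *)
Lemma exposed_le u v : s != [::] ->
  (forall a, a \in s -> exposed Q u a -> exposed Q v a) ->
  exposed Q u `<=` exposed Q v.
Proof.
move=> s0 uv x ux; have [e [a [_ sa [ua aP] _]]] := exposed_exposed u (- v) s0.
have va := uv a sa ua; apply: (exposedE va); first exact: exposed_sub ux.
apply/le_anti; rewrite va.2 ?andbT; last exact: exposed_sub ux.
by have := aP x ux; rewrite !dotNl lerN2.
Qed.

(** Stands in for the dimension as induction measure on faces: a strictly larger face contains more
    points of [s]. *)
Definition expcount u := count (fun a => `[< exposed Q u a >]) s.

Lemma count_lt (T : eqType) (p q : pred T) (r : seq T) (a : T) :
  (forall b : T, p b -> q b) -> a \in r -> q a -> ~~ p a ->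
  (count p r < count q r)%N.
Proof.
move=> pq + qa pa; elim: r => //= b r IH; rewrite inE => /predU1P[<-|/IH h].
  by rewrite qa (negPf pa) add0n add1n ltnS sub_count.
rewrite -addnS leq_add//; case: (boolP (p b)) => // /pq ->//.
Qed.

Lemma expcount_lt u v a : exposed Q u `<=` exposed Q v -> a \in s ->
  exposed Q v a -> ~ exposed Q u a -> (expcount u < expcount v)%N.
Proof.
move=> uv sa va ua; apply: (count_lt (a := a)) => //.
- by move=> x /asboolP /uv h; apply/asboolP.
- exact/asboolP.
- exact/asboolPn.
Qed.

Lemma vertex_exposed w : s != [::] -> exists2 z, vertex Q z & exposed Q w z.
Proof.
move=> s0; have [k] := ubnP (expcount w).
elim: k w => // k IH w; rewrite ltnS => wk.
have [a sa wa] := exposed_seq w s0.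
have [[b [sb wb ba]]|H] :=
  pselect (exists b, [/\ b \in s, exposed Q w b & b <> a]).
  (* The functional [b - a] is larger at [b] than at [a], so the refined face loses [b]. *)
  have [e [c [e0 sc [wc cP] E]]] := exposed_exposed w (b - a) s0.
  have [|z vz] := IH (w + e *: (b - a)).
    apply: leq_trans wk; apply: (@expcount_lt _ _ b) => //.
      by rewrite E; exact: exposed_sub.
    rewrite E => -[_ /(_ a wa)]; apply/negP; rewrite -ltNge -subr_gt0 -dotBr.
    by rewrite dot_gt0// subr_eq0; exact/eqP.
  by rewrite E => zE; exists z => //; exact: exposed_sub zE.
exists a => //; apply/vertexP; exists w; apply/seteqP; split;
  last by move=> x ->.
move=> x wx /=; have [e [c [_ sc [wc cP] _]]] := exposed_exposed w (a - x) s0.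
have ca : c = a by apply: contrapT => ca; apply: H; exists c.
have := cP x wx; rewrite ca -subr_ge0 -dotBr -opprB dotNl oppr_ge0 => h.
apply/eqP; rewrite -subr_eq0; apply: contraTT h => h.
by rewrite -ltNge dot_gt0.
Qed.

Lemma vertex_seq z : s != [::] -> vertex Q z -> z \in s.
Proof.
move=> s0 /vertexP[u uz]; have [a sa] := exposed_seq u s0.
by rewrite uz => <-.
Qed.

End FiniteHull.

(** Homogenization: lifting the points to height 1 turns convex combinations into conic ones, and
    the height coordinate of the Farkas separator cancels. *)
Lemma hull_separation (s : seq V) x : ~ hull [set` s] x ->
  exists v, forall a, a \in s -> dot v x < dot v a.
Proof.
move=> sx; pose lft u : 'rV[R]_(1 + n) := row_mx (1%:M) u.
have dotl u (w : 'rV_(1 + n)) :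
  dot (lft u) w = w 0 (lshift n 0) + dot u (rsubmx w).
  rewrite /dot big_split_ord/= big_ord1; congr (_ + _).
    by rewrite row_mxEl mxE mul1r.
  by apply: eq_bigr => i _; rewrite row_mxEr mxE.
have [[c c0 E]|[w aw xw]] := farkas (fun i : 'I_(size s) => lft s`_i) (lft x).
  exfalso; apply: sx; have c1 : \sum_i c i = 1.
    move/(congr1 (fun w : 'rV_(1 + n) => w 0 (lshift n 0))): E.
    rewrite row_mxEl mxE eqxx summxE mulr1n => ->; apply: eq_bigr => i _.
    by rewrite mxE row_mxEl mxE eqxx mulr1.
  exists (size s), (fun i => s`_i), c; split=> //; first by move=> i;
    exact: mem_nth.
  move/(congr1 (@rsubmx _ 1 1 n)): E; rewrite row_mxKr => ->.
  apply/rowP => j; rewrite mxE !summxE; apply: eq_bigr => i _.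
  by rewrite !mxE (unsplitK (inr j)).
exists (rsubmx w) => a sa; rewrite !(dotC (rsubmx w)).
have := aw (Ordinal (etrans (index_mem a s) sa)); rewrite /= nth_index// dotl.
by move: xw; rewrite dotl; lra.
Qed.

End Faces.

(** * Simplicial vertices and edges *)
Section SimplicialVertices.
Variables (R : realType) (n : nat).
Local Notation V := 'rV[R]_n.
Implicit Types (u v w x y z : V) (A B C Q F : set V) (b d : 'I_n -> V).

Definition finite_hull Q := exists2 s : seq V, s != [::] & Q = hull [set` s].

Lemma finite_hull_convex Q : finite_hull Q -> convex Q.
Proof. by move=> [s _ ->]; exact: convex_hull. Qed.

Lemma finite_hull_exposed2 Q w v : finite_hull Q ->
  exists2 e, 0 < e & exposed Q (w + e *: v) = exposed (exposed Q w) v.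
Proof.
by move=> [s s0 ->]; have [e [a [e0 _ _ ?]]] := exposed_exposed w v s0;
  exists e.
Qed.

Lemma finite_hull_vertex Q w : finite_hull Q ->
  exists2 z, vertex Q z & exposed Q w z.
Proof. by move=> [s s0 ->]; exact: vertex_exposed. Qed.

Lemma finite_hull_vertices Q : finite_hull Q ->
  exists r : seq V, forall z, z \in r <-> vertex Q z.
Proof.
move=> [s s0 QE]; exists [seq z <- s | `[< vertex Q z >]] => z.
rewrite mem_filter; split=> [/andP[/asboolP]//|vz].
by apply/andP; split; [exact/asboolP|apply: (vertex_seq s0); rewrite -QE].
Qed.

Lemma exposed_sumI Q (I : finType) (P : pred I) (f : I -> V) x y :
  Q x -> (forall i, P i -> exposed Q (f i) x) ->
  exposed Q (\sum_(i | P i) f i) y -> forall i, P i -> exposed Q (f i) y.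
Proof.
move=> Qx fx yP i Pi; rewrite (bigD1 i)//= in yP.
by apply: exposedD yP; [exact: fx|apply: exposed_sum => // j /andP[/fx]].
Qed.

(* [b] generates the normal cone of [Q] at [x], and [d] its tangent cone. *)
Definition simplicial Q x b d :=
  [/\ Q x, dual_bases b d &
      forall u, exposed Q u x <-> forall j, 0 <= dot u (d j)].

Definition simple_hull Q := finite_hull Q /\
  forall z, vertex Q z -> exists b d, simplicial Q z b d.

Lemma simplicial_exposed Q x b d j : simplicial Q x b d -> exposed Q (b j) x.
Proof. by move=> [Qx bd xP]; apply/xP => i; rewrite bd; case: eqP. Qed.

Lemma edge_sym Q x y : edge Q x y -> edge Q y x.
Proof. by rewrite /edge setUC => -[xy ?]; split=> // yx; exact: xy. Qed.

(** All generators but [b j] together expose the face along [d j]; its far end minimizes [- b j] on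
    that face. *)
Lemma simplicial_edge Q x b d j : finite_hull Q -> simplicial Q x b d ->
  exists y t, [/\ 0 < t, vertex Q y, y = x + t *: d j & edge Q x y].
Proof.
move=> Qf Qx; have [xQ bd xP] := Qx; pose w := \sum_(i | i != j) b i.
have bx i : exposed Q (b i) x by exact: simplicial_exposed Qx.
have wx : exposed Q w x by exact: exposed_sum.
have line y : exposed Q w y -> y = x + dot (b j) (y - x) *: d j.
  move=> wy; apply: (dual_inj bd) => i; rewrite dotDr dotZr bd.
  have [->|ij] := eqVneq i j; first by rewrite dotBr mulr1 addrC subrK.
  rewrite mulr0 addr0; apply: exposed_eq (bx i).
  exact: (exposed_sumI xQ (fun i _ => bx i) wy).
have [e e0 E] := finite_hull_exposed2 w (- b j) Qf.
have [z vz] := finite_hull_vertex (w + e *: - b j) Qf; rewrite E => -[wz zP].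
have zle y : exposed Q w y -> dot (b j) y <= dot (b j) z.
  by move=> /zP; rewrite !dotNl lerN2.
(* Otherwise [x] would itself minimize the perturbed functional, whose value on [d j] is [- e]. *)
have t0 : 0 < dot (b j) (z - x).
  rewrite lt_neqAle dotBr subr_ge0 zle// andbT eq_sym subr_eq0.
  apply/eqP => zx; have : exposed Q (w + e *: - b j) x.
    by rewrite E; split=> // y /zP; rewrite !dotNl zx.
  move=> /xP/(_ j); rewrite !dotE bd eqxx mulrN mulr1 dot_suml big1 ?add0r;
    last first.
    by move=> i ij; rewrite bd (negPf ij).
  by rewrite oppr_ge0 leNgt e0.
exists z, (dot (b j) (z - x)); split=> //; first exact: line.
split; first by move=> xz; move: t0; rewrite xz subrr dot0r ltxx.
right; exists w; apply/seteqP; split=> y.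
  move=> /hull2[t t01 ->]; apply: (convex_exposed _ wx wz t01).
  exact: finite_hull_convex.
move=> wy; apply/hull2.
exists (dot (b j) (y - x) / dot (b j) (z - x)).
  rewrite divr_ge0 ?(ltW t0)// ?ler_pdivrMr// ?mul1r !dotBr ?lerD2r ?zle//.
  by rewrite subr_ge0; case: (bx j) => _; apply; exact: exposed_sub wy.
rewrite [in LHS](line y wy) [X in _ *:
  (X - x)](line z wz) [x + _ - x]addrC addKr.
by rewrite scalerA divfK// gt_eqF.
Qed.

(** Complementary slackness: [y - x] is a nonnegative combination of the [d i], and the functional
    exposing the edge kills every [d i] that occurs. The far end of the edge along such a [d j] lies
    on the given segment, which fixes the direction. *)
Lemma edge_direction Q x y b d : finite_hull Q -> simplicial Q x b d ->
  edge Q x y -> exists j t, 0 < t /\ y = x + t *: d j.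
Proof.
move=> Qf Qx [xy [/seteqP[/(_ x)]|[w wE]]].
  by case; apply/hull2; exists 0; rewrite ?lexx ?ler01// scale0r addr0.
have wx : exposed Q w x.
  by rewrite -wE; apply/hull2; exists 0; rewrite ?lexx ?ler01// scale0r addr0.
have wy : exposed Q w y.
  rewrite -wE; apply/hull2; exists 1; rewrite ?lexx ?ler01// scale1r.
  by rewrite addrC subrK.
have [xQ bd xP] := Qx; pose c i := dot (b i) (y - x).
have c0 i : 0 <= c i.
  rewrite /c dotBr subr_ge0; have [_] := simplicial_exposed i Qx; apply.
  exact: exposed_sub wy.
have yE : y - x = \sum_i c i *: d i.
  by rewrite [LHS](dual_expand _ (dual_bases_sym bd));
    under eq_bigr do rewrite dotC.
have wd i : 0 <= dot w (d i) by exact: (xP w).1.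
have cw i : c i * dot w (d i) = 0.
  have : \sum_i c i * dot w (d i) = 0.
    rewrite (eq_bigr (fun i => dot w (c i *: d i))); last by move=> *;
      rewrite dotZr.
    by rewrite -dot_sumr -yE dotBr (exposed_eq wx wy) subrr.
  move=> /eqP; rewrite psumr_eq0; last by move=> k _; rewrite mulr_ge0.
  by move=> /allP/(_ i (mem_index_enum i))/eqP.
have [[j cj]|H] := pselect (exists j, c j != 0); last first.
  exfalso; apply: xy; apply/esym/eqP; rewrite -subr_eq0 yE big1// => i _.
  by have [->|ci] := eqVneq (c i) 0; [rewrite scale0r|case: H; exists i].
have [z [t [t0 vz zE _]]] := simplicial_edge j Qf Qx.
have : hull [set x; y] z.
  rewrite wE; apply: (exposedE wx); first exact: vertex_in.
  move: (cw j) => /eqP; rewrite mulf_eq0 (negPf cj)/= => /eqP wj.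
  by rewrite zE !dotE wj mulr0 addr0.
move=> /hull2[r /andP[r0 _]]; rewrite zE => /addrI td.
have r_gt0 : 0 < r.
  rewrite lt_neqAle r0 andbT; apply/eqP => r_eq0; move: td.
  rewrite -r_eq0 scale0r => /(congr1 (dot (b j)));
    rewrite dotZr bd eqxx mulr1 dot0r.
  by move=> t_eq0; rewrite t_eq0 ltxx in t0.
exists j, (t / r); split; first exact: divr_gt0.
apply/eqP; rewrite -subr_eq0 opprD addrA subr_eq0; apply/eqP.
by rewrite mulrC -scalerA td scalerA mulVf ?scale1r// gt_eqF.
Qed.

(** A lowest vertex [y] outside the face is a neighbor: some edge at [y] decreases [u], and its
    other end can only lie in the face. *)
Lemma depth_attained Q u q : simple_hull Q -> Q q -> ~ exposed Q u q ->
  exists y, [/\ neighbor Q (exposed Q u) y,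
    depth Q (exposed Q u) u = dot u y - supp Q u &
    forall z, vertex Q z -> ~ exposed Q u z -> dot u y <= dot u z].
Proof.
move=> [Qf Qs] Qq uq; have [r rP] := finite_hull_vertices Qf.
have [p vp up] := finite_hull_vertex u Qf.
have [a va ua] := finite_hull_vertex (- u) Qf.
pose r' := [seq z <- r | `[< ~ exposed Q u z >]].
have r'P z : z \in r' <-> vertex Q z /\ ~ exposed Q u z.
  rewrite mem_filter -rP; split=> [/andP[/asboolP]//|[-> ?]].
  by rewrite andbT; exact/asboolP.
have ar' : a \in r'.
  apply/r'P; split=> // ua'; apply: uq; apply: (exposedE up) => //.
  apply/le_anti; rewrite up.2// andbT (exposed_eq up ua').
  by have := ua.2 _ Qq; rewrite !dotNl lerN2.
have [|y /r'P[vy uy] yP] := @seq_min _ _ (dot u) r'; first by case: (r') ar'.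
have [b [d Qy]] := Qs y vy; have [yQ bd bP] := Qy.
have [j uj] : exists j, dot u (d j) < 0.
  apply: contrapT => H; apply: uy; apply/bP => j; rewrite leNgt.
  by apply/negP => uj; apply: H; exists j.
have [z [t [t0 vz zE yz]]] := simplicial_edge j Qf Qy.
have uz : exposed Q u z.
  apply: contrapT => uz; have /yP : z \in r' by apply/r'P.
  by rewrite zE !dotE lerDl pmulr_rge0// leNgt uj.
have ny : neighbor Q (exposed Q u) y.
  by split=> //; exists z; split=> //; exact: edge_sym.
exists y; split=> //; last by move=> z' vz' uz'; apply/yP/r'P.
apply/le_anti/andP; split.
  apply: ge_inf; last by exists y.
  exists 0 => _ [z' [vz' _ _] <-]; rewrite subr_ge0 (supp_exposed up).
  by apply: up.2; exact: vertex_in.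
apply: lb_le_inf; first by exists (dot u y - supp Q u), y.
by move=> _ [z' [vz' uz' _] <-]; rewrite lerD2r; apply/yP/r'P.
Qed.

Lemma depth_le_vertex Q u z : simple_hull Q -> vertex Q z -> ~ exposed Q u z ->
  depth Q (exposed Q u) u <= dot u z - supp Q u.
Proof.
move=> Qs vz uz; have [y [_ -> yP]] := depth_attained Qs (vertex_in vz) uz.
by rewrite lerD2r yP.
Qed.

Lemma depth_gt0 Q u q : simple_hull Q -> Q q -> ~ exposed Q u q ->
  0 < depth Q (exposed Q u) u.
Proof.
move=> Qs Qq uq; have [y [[vy uy _] -> _]] := depth_attained Qs Qq uq.
have [p _ up] := finite_hull_vertex u Qs.1.
rewrite (supp_exposed up) subr_gt0 lt_neqAle up.2 ?andbT; last exact: vertex_in.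
by apply/eqP => py; apply: uy; apply: (exposedE up) => //; exact: vertex_in.
Qed.

End SimplicialVertices.

(** * Cuts by half-spaces *)
Section Cuts.
Variables (R : realType) (n : nat).
Local Notation V := 'rV[R]_n.
Implicit Types (u v w x y z : V) (A B C Q F : set V).

(** Each [a] bounds [l] by [f a / g a], from above if [g a] is positive and from below if it is
    negative. The second hypothesis makes the bounds compatible; the witness is the largest lower
    bound, or 0. *)
Lemma lagrange_seq (T : eqType) (f g : T -> R) (s : seq T) :
  (forall a, a \in s -> 0 <= g a -> 0 <= f a) ->
  (forall p q, p \in s -> q \in s -> 0 < g p -> g q < 0 ->
     f p * g q <= f q * g p) ->
  exists2 l, 0 <= l & forall a, a \in s -> l * g a <= f a.
Proof.
move=> f0 fg; pose r := [seq q <- s | g q < 0].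
have [r0|r0] := eqVneq r [::].
  exists 0 => // a sa; rewrite mul0r f0// leNgt; apply/negP => ga.
  by have : a \in r; [rewrite mem_filter ga|rewrite r0].
have [q + qP] := seq_min (fun q => - (f q / g q)) r0.
rewrite mem_filter => /andP[gq sq].
have fq p : p \in s -> g p < 0 -> f p / g p <= f q / g q.
  by move=> sp gp; rewrite -lerN2 qP// mem_filter gp.
exists (Num.max 0 (f q / g q)) => [|a sa]; first by rewrite le_max lexx.
have [ga|ga|ga] := ltgtP (g a) 0.
- by rewrite -ler_ndivrMr// le_max fq// orbT.
- rewrite -ler_pdivlMr// ge_max divr_ge0 ?(ltW ga) ?f0 ?(ltW ga)//=.
  by rewrite ler_pdivlMr// mulrAC ler_ndivrMr// fg.
- by rewrite ga mulr0 f0// ga.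
Qed.

Definition cut Q u (c : R) := Q `&` [set x | c <= dot u x].

Lemma cut_sub Q u c : cut Q u c `<=` Q. Proof. by move=> x []. Qed.

Lemma convex_cut Q u c : convex Q -> convex (cut Q u c).
Proof. by move=> Qc; apply: convexI => //; exact: convex_halfspace. Qed.

Lemma convex_cross Q u c p q : convex Q -> Q p -> Q q ->
  c < dot u p -> dot u q < c ->
  exists t, [/\ 0 < t < 1, Q (q + t *: (p - q)),
    dot u (q + t *: (p - q)) = c & t = (c - dot u q) / (dot u p - dot u q)].
Proof.
move=> Qc Qp Qq up uq; have upq : 0 < dot u p - dot u q by lra.
exists ((c - dot u q) / (dot u p - dot u q)).
have t01 : 0 < (c - dot u q) / (dot u p - dot u q) < 1.
  by rewrite divr_gt0 ?ltr_pdivrMr ?mul1r// ?ltrD2r// subr_gt0.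
split=> //.
  by apply: Qc => //; case/andP: t01 => /ltW -> /ltW ->.
by rewrite !dotE divfK ?gt_eqF// addrC subrK.
Qed.

(** Duality for a single constraint: a bound at the kept generators and at the points where segments
    between generators cross the hyperplane yields a multiplier valid on the whole hull. *)
Lemma lagrange_cut (s : seq V) u v (c r : R) :
  (forall a, a \in s -> c <= dot u a -> r <= dot v a) ->
  (forall p q t, p \in s -> q \in s -> c < dot u p -> dot u q < c ->
     t = (c - dot u q) / (dot u p - dot u q) -> r <= dot v (q + t *:
       (p - q))) ->
  exists2 l, 0 <= l & forall x, hull [set` s] x ->
    l * (dot u x - c) <= dot v x - r.
Proof.
move=> H1 H2; have [a sa|p q sp sq|l l0 lP] :=
  @lagrange_seq _ (fun a => dot v a - r) (fun a => dot u a - c) s.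
- by rewrite !subr_ge0; exact: H1.
- rewrite subr_gt0 subr_lt0 => up uq; have upq : 0 < dot u p - dot u q by lra.
  have := H2 p q _ sp sq up uq erefl; set t := _ / _;
    rewrite !dotE -subr_ge0 => h.
  have tE : t * (dot u p - dot u q) = c - dot u q by rewrite divfK// gt_eqF.
  have := mulr_ge0 h (ltW upq).
  have -> : (dot v q + t * (dot v p - dot v q) - r) * (dot u p - dot u q) =
    (dot v q - r) * (dot u p - dot u q) + (c - dot u q) * (dot v p - dot v q).
    by rewrite -tE; ring.
  nra.
- exists l => // x Qx; rewrite -subr_ge0.
  have -> : dot v x - r - l * (dot u x - c) = dot (v - l *: u) x - (r - l * c).
    by rewrite !dotE; ring.
  rewrite subr_ge0; apply: hull_dot_ge Qx => a /lP; rewrite !dotE; lra.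
Qed.

(** Kept generators and crossing points generate the cut: a point of it separated from them would
    violate the inequality of [lagrange_cut]. *)
Lemma finite_hull_cut Q u c q : finite_hull Q -> Q q -> c <= dot u q ->
  finite_hull (cut Q u c).
Proof.
move=> [s s0 QE] Qq cq; have Qc : convex Q by rewrite QE; exact: convex_hull.
have sQ a : a \in s -> Q a by rewrite QE => sa; exact: sub_hull.
pose cross p q := q + ((c - dot u q) / (dot u p - dot u q)) *: (p - q).
pose s1 := [seq a <- s | c <= dot u a].
pose s2 := [seq cross p q | p <- [seq p <- s | c < dot u p],
                            q <- [seq q <- s | dot u q < c]].
have s1P a : a \in s -> c <= dot u a -> a \in s1 ++ s2.
  by move=> sa ca; rewrite mem_cat mem_filter ca sa.
have s'0 : s1 ++ s2 != [::].
  have [a sa aP] := seq_min (fun a => - dot u a) s0.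
  suff : a \in s1 ++ s2 by case: (s1 ++ s2).
  apply: s1P => //; apply: le_trans cq _; rewrite -lerN2 -!dotNl.
  by rewrite QE in Qq; apply: hull_dot_ge Qq => b sb; rewrite !dotNl; exact: aP.
exists (s1 ++ s2) => //; apply/seteqP; split; last first.
  apply: hull_least; first exact: convex_cut.
  move=> a /=; rewrite mem_cat => /orP[|].
    by rewrite mem_filter => /andP[ca sa]; split=> //; exact: sQ.
  move=> /allpairsP[[p p'] /= [+ + ->]]; rewrite !mem_filter.
  move=> /andP[up sp] /andP[uq' sq'].
  have [t [_ Qt ut tE]] := convex_cross Qc (sQ _ sp) (sQ _ sq') up uq'.
  by rewrite /cross -tE; split; rewrite //= ut.
move=> x [Qx cx]; apply: contrapT => /hull_separation[v vx].
have [m ms mP] := seq_min (dot v) s'0.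
have [||l l0 lP] := @lagrange_cut s u v c (dot v m).
- by move=> a sa ca; apply/mP/s1P.
- move=> p p' t sp sp' up up' ->; apply: mP; rewrite mem_cat; apply/orP; right.
  by apply/allpairsP; exists (p, p'); rewrite !mem_filter up up' sp sp'.
have := lP x; rewrite -QE => /(_ Qx); have := vx m ms.
have : 0 <= l * (dot u x - c) by rewrite mulr_ge0// subr_ge0.
lra.
Qed.

(** An inactive constraint does not matter: the segment from [z] to a point of [Q] beyond the
    hyperplane crosses it inside the cut, and linearity extends the comparison. *)
Lemma exposed_cut_interior Q u c z w : convex Q -> cut Q u c z ->
  c < dot u z -> exposed (cut Q u c) w z -> exposed Q w z.
Proof.
move=> Qc [Qz _] cz [_ zP]; split=> // y Qy.
have [cy|yc] := leP c (dot u y); first exact: zP.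
have [t [/andP[t0 t1] Qt ut _]] := convex_cross Qc Qz Qy cz yc.
have : dot w z <= dot w (y + t *: (z - y)) by apply: zP; split; rewrite //= ut.
rewrite !dotE => h; have : 0 <= (1 - t) * (dot w y - dot w z) by lra.
by rewrite pmulr_rge0 ?subr_gt0// subr_ge0.
Qed.

Lemma vertex_cut_interior Q u c z : convex Q -> vertex (cut Q u c) z ->
  c < dot u z -> vertex Q z.
Proof.
move=> Qc vz cz; have Tz := vertex_in vz; have [Qz _] := Tz.
move: vz => /vertexP[w wE]; apply/vertexP; exists w.
have Tw : exposed (cut Q u c) w z by rewrite wE.
have wz : exposed Q w z := exposed_cut_interior Qc Tz cz Tw.
apply/seteqP; split=> [y wy|_ ->//].
have Ty t : c <= dot u (y + t *: (z - y)) -> 0 <= t <= 1 -> y + t *: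
  (z - y) = z.
  move=> ct t01; have : exposed (cut Q u c) w (y + t *: (z - y)).
    have wt : exposed Q w (y + t *: (z - y)) by exact: convex_exposed.
    by apply: (exposedE Tw); [split=> //;
      exact: exposed_sub wt|exact: exposed_eq wt wz].
  by rewrite wE.
have [cy|yc] := leP c (dot u y).
  by have := Ty 0; rewrite scale0r addr0 lexx ler01; exact.
have [t [/andP[t0 t1] _ ut _]] := convex_cross Qc Qz (exposed_sub wy) cz yc.
have := Ty t; rewrite ut lexx !ltW// => /(_ isT isT) /rowP E.
apply/rowP => i; have := E i; rewrite !mxE => h.
have : (1 - t) * (y 0 i - z 0 i) = 0 by lra.
by move=> /eqP; rewrite mulf_eq0 !subr_eq0 (gt_eqF t1) => /eqP.
Qed.

(** The normal cone at a boundary point grows exactly by the ray of [u]; [l] is the Lagrange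
    multiplier. *)
Lemma exposed_cut_boundary Q u c z w : finite_hull Q -> cut Q u c z ->
  dot u z = c -> exposed (cut Q u c) w z <->
  exists2 l, 0 <= l & exposed Q (w - l *: u) z.
Proof.
move=> Qf [Qz _] uz; split=> [[_ zP]|[l l0 [_ zP]]]; last first.
  split=> [|y [Qy /= cy]]; first by split; rewrite //= uz.
  have := zP y Qy; rewrite !dotE uz => h.
  have : 0 <= l * (dot u y - c) by rewrite mulr_ge0// subr_ge0.
  lra.
have Qc := finite_hull_convex Qf; have [s s0 QE] := Qf.
have sQ a : a \in s -> Q a by rewrite QE => sa; exact: sub_hull.
have [||l l0 lP] := @lagrange_cut s u w c (dot w z).
- by move=> a sa ca; apply: zP; split=> //; exact: sQ.
- move=> p q t sp sq up uq tE; apply: zP.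
  have [t' [_ Qt ut t'E]] := convex_cross Qc (sQ _ sp) (sQ _ sq) up uq.
  by rewrite tE -t'E; split; rewrite //= ut.
exists l => //; split=> // y Qy; rewrite !dotE uz.
have := lP y; rewrite -QE => /(_ Qy); lra.
Qed.

Lemma vertex_cut_boundary Q u c z : finite_hull Q -> vertex (cut Q u c) z ->
  dot u z = c -> ~ vertex Q z ->
  exists a b, [/\ edge Q a b, vertex Q a, vertex Q b, dot u a < c < dot u b &
    exists2 t, 0 < t < 1 & z = a + t *: (b - a)].
Proof.
move=> Qf vz uz nz; have [Qz _] := vertex_in vz.
have Qc := finite_hull_convex Qf.
have /vertexP[w wE] := vz.
have Tw : exposed (cut Q u c) w z by rewrite wE.
have [l l0 Ez] := (exposed_cut_boundary w Qf (vertex_in vz) uz).1 Tw.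
set w' := w - _ in Ez; have Ec := @convex_exposed _ _ Q w' Qc.
(* On the hyperplane [w] and [w'] differ by a constant, so the face of [Q] exposed by [w'] meets it
   in [z] alone. Such a face can only be a segment crossing the hyperplane. *)
have uniq y : exposed Q w' y -> dot u y = c -> y = z.
  move=> Ey uy; have : exposed (cut Q u c) w y; last by rewrite wE.
  apply: (exposedE Tw); first by split; [exact: exposed_sub Ey|rewrite /= uy].
  by have := exposed_eq Ey Ez; rewrite /w' !dotE uz uy => /addIr.
have ext v : exists2 a, vertex Q a & exposed (exposed Q w') v a.
  have [e _ <-] := finite_hull_exposed2 w' v Qf; exact: finite_hull_vertex.
have [a va [Ea aP]] := ext u; have [b vb [Eb bP]] := ext (- u).
have ua : dot u a < c.
  rewrite lt_neqAle -{2}uz aP// andbT; apply/eqP => ua; apply: nz.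
  by rewrite -(uniq a Ea ua).
have ub : c < dot u b.
  rewrite lt_neqAle -{2}uz; have := bP z Ez; rewrite !dotNl lerN2 => ->.
  by rewrite andbT; apply/eqP => ub; apply: nz; rewrite -(uniq b Eb).
have [t [t01 Et ut _]] := convex_cross Ec Eb Ea ub ua.
have zE := uniq _ Et ut.
exists a, b; split=> //; [|by rewrite ua ub|by exists t].
have uab : 0 < dot u b - dot u a by lra.
split; first by move=> ab; rewrite ab subrr ltxx in uab.
right; exists w'; apply/seteqP; split=> y.
  by move=> /hull2[r r01 ->]; exact: Ec.
(* The segment from [y] to the end on the other side crosses the hyperplane within the face, hence
   at [z], which puts [y] on the line through [a] and [b]. *)
move=> Ey; suff [k yE] : exists k, y = a + k *: (b - a).
  apply/hull2; exists k => //; have := aP y Ey; have := bP y Ey.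
  rewrite !dotNl lerN2 yE !dotE => h1 h2; apply/andP; split.
    by rewrite -(pmulr_lge0 _ uab); lra.
  rewrite -subr_ge0 -(pmulr_lge0 _ uab) mulrBl; lra.
have [yc|cy|yc] := ltgtP (dot u y) c.
- have [r [/andP[r0 r1] Er ur _]] := convex_cross Ec Eb Ey ub yc.
  have := uniq _ Er ur; rewrite -zE => E.
  exists ((t - r) / (1 - r)); have r1' : 1 - r != 0 by rewrite subr_eq0 gt_eqF.
  apply: (scalerI r1'); rewrite scalerDr scalerA mulrC divfK//.
  apply/rowP => i; move/rowP/(_ i): E; rewrite !mxE; nra.
- have [r [/andP[r0 r1] Er ur _]] := convex_cross Ec Ey Ea cy ua.
  have := uniq _ Er ur; rewrite -zE => /addrI E.
  exists (t / r); rewrite mulrC -scalerA -E scalerA mulVf ?gt_eqF//.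
  by rewrite scale1r addrC subrK.
- by exists t; rewrite (uniq _ Ey yc).
Qed.

Lemma simplicial_cut Q u c a (b d : 'I_n -> V) j s t :
  finite_hull Q -> simplicial Q a b d ->
  0 < s < t -> Q (a + t *: d j) -> 0 < dot u (d j) ->
  dot u (a + s *: d j) = c ->
  exists d', simplicial (cut Q u c) (a + s *: d j)
    (fun i => if i == j then u else b i) d'.
Proof.
move=> Qf [Qa bd aP] /andP[s0 st] Qt uj uz; set z := a + s *: d j in uz *.
have t0 : 0 < t by exact: lt_trans st.
have Qz : Q z.
  have -> : z = a + (s / t) *: (a + t *: d j - a).
    by rewrite [a + t *: _]addrC addrK scalerA divfK// gt_eqF.
  apply: finite_hull_convex => //.
  by rewrite divr_ge0 ?ler_pdivrMr// ?mul1r// ltW.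
have Tz : cut Q u c z by split; rewrite //= uz.
(* The dual of the modified basis: [d j] is rescaled to pair to 1 with [u], and the other [d i] are
   sheared along [d j] into the kernel of [u]. *)
pose k i := dot u (d i) / dot u (d j).
exists (fun i => if i == j then (dot u (d j))^-1 *: d j else d i - k i *: d j).
split=> // [i i'|v].
  have [ij|ij] := eqVneq i j; have [i'j|i'j] := eqVneq i' j; rewrite ?ij ?i'j.
  - by rewrite dotZr eqxx mulVf // gt_eqF.
  - by rewrite !dotE eq_sym (negPf i'j) divfK ?subrr // gt_eqF.
  - by rewrite dotZr bd (negPf ij) mulr0.
  - by rewrite !dotE !bd (negPf ij) mulr0 subr0.
rewrite exposed_cut_boundary//; split.
  (* The point lies strictly inside a segment of [Q] of direction [d j], so a functional minimized
     there is constant along [d j] and also minimized at [a]. *)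
  move=> [l l0 lz]; have lj : dot (v - l *: u) (d j) = 0.
    have := lz.2 _ Qt; have := lz.2 _ Qa;
      rewrite /z !(dotDr (v - _)) !dotZr => h1 h2.
    have : s * dot (v - l *: u) (d j) <= 0 by lra.
    have : 0 <= (t - s) * dot (v - l *: u) (d j) by lra.
    rewrite pmulr_rle0// pmulr_rge0 ?subr_gt0// => g1 g2.
    by apply/le_anti; rewrite g1 g2.
  have la : exposed Q (v - l *: u) a.
    by apply: (exposedE lz) => //;
      rewrite /z !(dotDr (v - _)) !dotZr lj mulr0 addr0.
  have vj : dot v (d j) = l * dot u (d j).
    by apply/eqP; rewrite -subr_eq0 -dotZl -dotBl lj.
  move=> i; case: (eqVneq i j) => [_|ij].
    by rewrite dotZr vj mulrC mulfK// gt_eqF.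
  have := (aP _).1 la i; rewrite !dotE vj /k.
  by rewrite [_ / _ * _]mulrC -mulrA [_ * (_ / _)]mulrC divfK// gt_eqF.
move=> H; exists (dot v (d j) / dot u (d j)).
  by have := H j; rewrite eqxx dotZr mulrC.
set v' := v - _; have v'j : dot v' (d j) = 0.
  by rewrite /v' !dotE divfK ?gt_eqF// subrr.
have v'a : exposed Q v' a.
  apply/aP => i; have [->|ij] := eqVneq i j; first by rewrite v'j.
  have := H i; rewrite (negPf ij) /v' /k !dotE.
  by rewrite [_ / _ * dot v _]mulrAC [in X in _ ->
    X]mulrAC [dot v (d j) * _]mulrC.
by apply: (exposedE v'a) => //; rewrite /z dotDr dotZr v'j mulr0 addr0.
Qed.

End Cuts.

(** * Facets *)
Section Lattices.
Variables (R : realType) (n : nat).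
Local Notation V := 'rV[R]_n.
Implicit Types (u v w x y : V) (L : set V).

Lemma zspan_sub (M : zmodType) (A : set M) : A `<=` zspan A.
Proof.
by move=> x Ax; exists 1%N, (fun=> x), (fun=> 1); rewrite big_ord1 mulr1z.
Qed.

Lemma dual_lattice_sum L (I : Type) (r : seq I) (P : pred I) f :
  (forall i, P i -> dual_lattice L (f i)) ->
  dual_lattice L (\sum_(i <- r | P i) f i).
Proof.
move=> fL x Lx; rewrite dot_suml rpred_sum// => i Pi; exact: fL.
Qed.

(** Descent: for some lattice vector [r] the integer [dot u r] is nonzero, and each division of [u]
    by some [k > 1] decreases its absolute value. *)
Lemma primitive_exists L u : lattice L -> dual_lattice L u -> u <> 0 ->
  exists v k, [/\ (0 < k)%N, primitive (dual_lattice L) v & u = v *+ k].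
Proof.
move=> [B Bu LE] Lu u0; have rL i : L (row i B) by rewrite LE;
  apply: zspan_sub; exists i.
have [i ui] : exists i, dot u (row i B) != 0.
  apply: contrapT => H; apply: u0;
    apply: (can_inj (mulmxK (_ : B^T \in unitmx))).
    by rewrite unitmx_tr.
  rewrite mul0mx; apply/rowP => i; rewrite !mxE; apply/eqP/negPn/negP => ui.
  apply: H; exists i; apply: contra ui => /eqP ui; apply/eqP; rewrite -[RHS]ui.
  by apply: eq_bigr => j _; rewrite !mxE.
set r := row i B in ui.
have [N] : exists N : nat, `|dot u r| < N%:R.
  by exists (Num.bound (dot u r)); have := archi_boundP (normr_ge0 (dot u r));
     rewrite /Num.bound normr_id.
elim: N u Lu {u0} ui => [|N IH] u Lu ui; first by rewrite ltNge normr_ge0.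
move=> uN; have [pu|npu] := pselect (primitive (dual_lattice L) u).
  by exists u, 1%N.
have [w [k [Lw wk k1]]] :
  exists w k, [/\ dual_lattice L w, u = w *+ k & k <> 1%N].
  apply: contrapT => H; apply: npu; split=> //.
    by move=> u0; rewrite u0 dot0l eqxx in ui.
  by move=> w k Lw wk; apply: contrapT => k1; apply: H; exists w, k.
have uw : dot u r = k%:R * dot w r by rewrite wk -scaler_nat dotZl.
have k2 : (1 < k)%N.
  case: k k1 wk {uw} => [_ wk|[//|//]].
  by rewrite wk mulr0n dot0l eqxx in ui.
have wr : dot w r != 0 by apply: contraNneq ui => wr; rewrite uw wr mulr0.
have [|v [l [l0 pv vl]]] := IH w Lw wr.
  have w1 := norm_intr_ge1 (Lw r (rL i)) wr.
  move: uN; rewrite uw normrM normr_nat -natr1.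
  have : 2%:R <= k%:R :> R by rewrite ler_nat.
  nra.
exists v, (l * k)%N; split=> //; first by rewrite muln_gt0 l0 ltnW.
by rewrite wk vl mulrnA.
Qed.

End Lattices.

(** * Facets above a face and conic combinations of their normals *)

Section Facets.
Variables (R : realType) (n : nat).
Local Notation V := 'rV[R]_n.
Implicit Types (u v w x y : V) (L S F G : set V).

Lemma polytope_finite_hull L S : polytope L S -> finite_hull S.
Proof.
move=> [[A [/finite_seqP[s ->] SE]] [x Sx] _]; exists s => //.
by apply/eqP => s0; move: Sx; rewrite SE s0 => -[[|k] [p [c [pA _]]]];
   [rewrite big_ord0 => /eqP; rewrite eq_sym oner_eq0|have := pA ord0].
Qed.

Lemma interior_direction S x v :
  interior S x -> exists2 t, 0 < t & S (x + t *: v).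
Proof.
move=> /nbhs_ballP[e /= e0 eS]; have v0 : 0 < 1 + `|v| by rewrite ltr_pwDl.
exists (e / 2 / (1 + `|v|)); first by rewrite !divr_gt0.
apply: eS; rewrite -ball_normE /= opprD addNKr normrN normrZ.
rewrite gtr0_norm ?divr_gt0// mulrAC ltr_pdivrMr//.
have := normr_ge0 v; nra.
Qed.

Lemma full_dim_exposed S u : full_dim S -> S `<=` exposed S u -> u = 0.
Proof.
move=> [x Sx] H; have [t t0 St] := interior_direction u Sx.
have := exposed_eq (H _ St) (H _ (interior_subset Sx)).
rewrite !dotE => /eqP; rewrite addrC -subr_eq0 addrK mulf_eq0 gt_eqF//=.
by move=> /eqP/dot_eq0.
Qed.

Lemma nonempty_proper_faceP S F : finite_hull S -> full_dim S ->
  nonempty_proper_face S F <-> exists2 u, u <> 0 & F = exposed S u.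
Proof.
move=> Sf Sd; split=> [[[[->|[u FE]] [_ pF]] [x Fx]]|[u u0 ->]]; first by [].
  by exists u => // u0; apply: pF; rewrite FE u0 exposed0.
split; first split; first by right; exists u.
  split; first exact: exposed_sub.
  by move=> /full_dim_exposed; move/(_ Sd).
by have [z _ uz] := finite_hull_vertex u Sf; exists z.
Qed.

Lemma exposed_sub_facet S u : finite_hull S -> full_dim S -> u <> 0 ->
  exists2 G, facet S G & exposed S u `<=` G.
Proof.
move=> Sf Sd; have [s s0 SE] := Sf; have [k] := ubnP (size s - expcount s u)%N.
elim: k u => // k IH u; rewrite ltnS => uk u0.
have Fu : nonempty_proper_face S (exposed S u).
  by apply/nonempty_proper_faceP => //; exists u.
have [fu|nfu] := pselect (facet S (exposed S u)); first by exists (exposed S u).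
have [F [pF uF Fu']] : exists F,
    [/\ proper_face S F, exposed S u `<=` F & F <> exposed S u].
  apply: contrapT => H; apply: nfu; split=> // F pF uF.
  by apply: contrapT => Fu'; apply: H; exists F.
have [v v0 FE] : exists2 v, v <> 0 & F = exposed S v.
  apply/nonempty_proper_faceP => //; split=> //.
  by have [_ [x ux]] := Fu; exists x; exact: uF.
have [a [sa va ua]] : exists a, [/\ a \in s, exposed S v a & ~ exposed S u a].
  apply: contrapT => H; apply: Fu'; apply/seteqP; split=> //.
  rewrite FE SE; apply: exposed_le => // a sa; rewrite -SE => va.
  by apply: contrapT => ua; apply: H; exists a.
have cuv : (expcount s u < expcount s v)%N.
  by rewrite (@expcount_lt _ _ s u v a)// -SE// -FE.
have [|//|G fG vG] := IH v.
  apply: leq_trans uk; apply: ltn_sub2l => //; apply: leq_trans cuv _.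
  exact: count_size.
by exists G => //; apply: subset_trans vG; rewrite -FE.
Qed.

(* Subtract from [u] the largest multiple of the normal of a facet through the
   face exposed by [u] that keeps [x] optimal: the exposed face grows. *)
Lemma facet_conic S (N : set V -> V) u x : finite_hull S -> full_dim S ->
  (forall G, facet S G -> exposed S (N G) = G) -> exposed S u x ->
  exists k (G : 'I_k -> set V) (c : 'I_k -> R),
    [/\ forall i, facet S (G i), forall i, exposed S u `<=` G i,
        forall i, 0 <= c i & u = \sum_i c i *: N (G i)].
Proof.
move=> Sf Sd NP; have [s s0 SE] := Sf.
have [k] := ubnP (size s - expcount s u)%N.
elim: k u => // k IH u; rewrite ltnS => uk ux.
have [->|/eqP u0] := eqVneq u 0.
  exists 0%N, (fun=> set0), (fun=> 0); rewrite big_ord0.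
  by split=> // -[].
have [G fG uG] := exposed_sub_facet Sf Sd u0.
have Gx : exposed S (N G) x by rewrite NP//; exact: uG.
have sS a : a \in s -> S a by rewrite SE => sa; exact: sub_hull.
pose r := [seq a <- s | 0 < dot (N G) (a - x)].
(* Otherwise [N G] would be constant on [S] and [G] would be all of [S]. *)
have r0 : r != [::].
  apply/eqP => r0; have [[_ [_ pG]] _] := fG.1; apply: pG.
  move=> y Sy; rewrite -(NP _ fG); apply: (exposedE Gx) => //.
  rewrite SE in Sy; apply: hull_dot_eq Sy => a sa.
  apply/le_anti; rewrite (Gx.2 _ (sS a sa)) andbT leNgt -subr_gt0 -dotBr.
  by apply/negP => ax; have : a \in r; [rewrite mem_filter ax|rewrite r0].
have [a + aP] := seq_min (fun a => dot u (a - x) / dot (N G) (a - x)) r0.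
rewrite mem_filter => /andP[Ga sa].
set t := dot u (a - x) / dot (N G) (a - x) in aP.
have ua : 0 < dot u (a - x).
  rewrite dotBr subr_gt0 lt_neqAle (ux.2 _ (sS a sa)) andbT.
  apply/eqP => E; have : exposed S u a by apply: (exposedE ux) => //; exact: sS.
  move=> /uG; rewrite -(NP _ fG) => Ga'.
  by move: Ga; rewrite dotBr (exposed_eq Ga' Gx) subrr ltxx.
have t0 : 0 < t by exact: divr_gt0.
pose v := u - t *: N G.
have vx : exposed S v x.
  split=> [|y Sy]; first exact: exposed_sub ux.
  rewrite SE in Sy; apply: hull_dot_ge Sy => c sc.
  rewrite -subr_ge0 -dotBr /v dotBl dotZl subr_ge0.
  have [cr|cr] := ltP 0 (dot (N G) (c - x)).
    by rewrite -ler_pdivlMr//; apply: aP; rewrite mem_filter cr.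
  apply: (@le_trans _ _ 0); first by rewrite pmulr_rle0.
  by rewrite dotBr subr_ge0 ux.2//; exact: sS.
have uv : exposed S u `<=` exposed S v.
  move=> y uy; apply: (exposedE vx); first exact: exposed_sub uy.
  have /exposed_eq /(_ Gx) h : exposed S (N G) y by rewrite NP//; exact: uG.
  by rewrite /v !dotE h (exposed_eq uy ux).
have cuv : (expcount s u < expcount s v)%N.
  rewrite (@expcount_lt _ _ s u v a) -?SE//.
    apply: (exposedE vx); first exact: sS.
    apply/eqP; rewrite -subr_eq0 -dotBr /v dotBl dotZl divfK ?subrr//.
    by rewrite gt_eqF.
  by move=> /exposed_eq /(_ ux) E; rewrite dotBr E subrr ltxx in ua.
have [|//|m [Gs [c [fGs vGs c0 vE]]]] := IH v.
  apply: leq_trans uk; apply: ltn_sub2l => //; apply: leq_trans cuv _.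
  exact: count_size.
exists m.+1, (fun i => if unlift ord0 i is Some j then Gs j else G),
  (fun i => if unlift ord0 i is Some j then c j else t).
split=> [i|i|i|]; first by case: unlift.
- by case: unlift => // j; apply: subset_trans (vGs j).
- by case: unlift => //; exact: ltW.
- rewrite big_ord_recl unlift_none; under eq_bigr do rewrite liftK.
  by rewrite -vE /v addrC subrK.
Qed.

End Facets.

(** * Facet normals at a vertex *)
Section VertexFrames.
Variables (R : realType) (n : nat) (L S : set 'rV[R]_n).
Hypotheses (hL : lattice L) (hS : polytope L S) (hfull : full_dim S).
Hypothesis hsimple : simple S.
Local Notation V := 'rV[R]_n.
Local Notation N := (facet_normal L S).
Local Notation U := (face_normal L S).
Implicit Types (u v w x y : V) (F G : set V).

Let Sf : finite_hull S := polytope_finite_hull hS.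

(** [xget] falls back to 0 unless a primitive normal exists; rationality of the facet supplies one.
    Maximality of [G] turns inclusion in the exposed face into equality. *)
Lemma facet_normalP G : facet S G ->
  exposed S (N G) = G /\ primitive (dual_lattice L) (N G).
Proof.
move=> fG; have [_ _ /(_ _ fG)[u Lu GE]] := hS.
have [v0 v0n GE'] := (nonempty_proper_faceP G Sf hfull).1 fG.1.
have u0 : u <> 0.
  move=> u0; apply: v0n; apply: (full_dim_exposed hfull).
  by rewrite -GE' GE u0 exposed0.
have [v [k [k0 pv uE]]] := primitive_exists hL Lu u0.
have Gv : exposed S v = G.
  by rewrite GE uE -scaler_nat exposedZ_eq ?ltr0n.
have [z _ vz] := finite_hull_vertex v Sf.
have [|nc pN] := @xgetPex _ 0 [set u | ncone S G u /\ primitive (dual_lattice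
  L) u].
  by exists v; split=> // x; rewrite -Gv => vx; rewrite (supp_exposed vx).
rewrite -/(N G) in nc pN; split=> //.
have [y _ Ny] := finite_hull_vertex (N G) Sf.
have GN : G `<=` exposed S (N G).
  move=> x Gx; apply: (exposedE Ny); last by rewrite -(supp_exposed Ny) nc.
  by move: Gx; rewrite GE; exact: exposed_sub.
apply: fG.2 => //; suff [] : nonempty_proper_face S (exposed S (N G)) by [].
by apply/nonempty_proper_faceP => //; exists (N G) => //; case: pN.
Qed.

Lemma facet_normal_exposed G : facet S G -> exposed S (N G) = G.
Proof. by move=> /facet_normalP[]. Qed.

(** The order of the facets is part of the data: it selects a full flag of faces through [x]. *)
Definition vertex_frame x (g : 'I_n -> set V) d :=
  [/\ injective g, forall G, (exists i, g i = G) <-> facet S G /\ G x &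
      simplicial S x (N \o g) d].

Lemma vertex_frame_exists x : vertex S x -> exists g d, vertex_frame x g d.
Proof.
move=> vx; have /card_esym/card_set_bijP[f [fA fI fS]] := hsimple vx.
pose g (i : 'I_n) := f i.
have gI : injective g.
  by move=> i j ij; apply/val_inj/fI => //; rewrite inE /=.
have gP G : (exists i, g i = G) <-> facet S G /\ G x.
  split=> [[i <-]|/fS[i /= i_n <-]]; first by apply: fA; exact: ltn_ord.
  by exists (Ordinal i_n).
have conic u : exposed S u x ->
    exists2 c : 'I_n -> R, forall i, 0 <= c i & u = \sum_i c i *: N (g i).
  move=> ux.
  have [k [G [c [fG uG c0 uE]]]] :=
    facet_conic Sf hfull facet_normal_exposed ux.
  have /choice[h hP] i : exists j, g j = G i by apply/gP; split=> //; exact: uG.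
  exists (fun j => \sum_(i | h i == j) c i); first by move=> j; exact: sumr_ge0.
  rewrite uE (partition_big h xpredT)//=; apply: eq_bigr => j _.
  by rewrite scaler_suml; apply: eq_bigr => i /eqP <-; rewrite hP.
(* The normal cone at a vertex is full-dimensional: [w + e *: v] stays in it for small [e], so any
   [v] is a multiple of a difference of two conic combinations. *)
have [d bd] : exists d, dual_bases (N \o g) d.
  apply: dual_bases_exists => v; have /vertexP[w wE] := vx.
  have wx : exposed S w x by rewrite wE.
  have [e e0 E] := finite_hull_exposed2 w v Sf.
  have wvx : exposed S (w + e *: v) x by rewrite E wE; split=> // y ->.
  have [c c0 cE] := conic _ wx; have [c' c'0 c'E] := conic _ wvx.
  exists (fun i => e^-1 * (c' i - c i)).
  have e_neq0 : e != 0 by rewrite gt_eqF.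
  apply: (scalerI e_neq0).
  rewrite -[LHS](addKr w) c'E {1}cE addrC scaler_sumr -sumrB.
  apply: eq_bigr => i _; rewrite scalerA mulrA divff ?gt_eqF// mul1r.
  by rewrite scalerBl.
exists g, d; split=> //; split=> [|//|u]; first exact: vertex_in.
split=> [ux i|ud].
  have [c c0 ->] := conic u ux; rewrite dot_suml (bigD1 i)//= big1 ?addr0.
    by rewrite dotZl (bd i i) eqxx mulr1.
  by move=> j ji; rewrite dotZl (bd j i) (negPf ji) mulr0.
rewrite (dual_expand u bd); apply: exposed_sum; first exact: vertex_in.
move=> i _; apply: exposedZ => //=; rewrite facet_normal_exposed.
  by have /gP[] : exists j, g j = g i by exists i.
by have /gP[] : exists j, g j = g i by exists i.
Qed.

Lemma simple_hullS : simple_hull S.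
Proof.
split=> // z /vertex_frame_exists[g [d [_ _ Sz]]]; by exists (N \o g), d.
Qed.

Section Frame.
Variables (x : V) (g : 'I_n -> set V) (d : 'I_n -> V).
Hypothesis fr : vertex_frame x g d.

Lemma frame_facet i : facet S (g i).
Proof. by have [_ gP _] := fr;
  have /gP[] : exists j, g j = g i by exists i. Qed.

Lemma frame_in i : g i x.
Proof. by have [_ gP _] := fr;
  have /gP[] : exists j, g j = g i by exists i. Qed.

Lemma frame_exposed i : exposed S (N (g i)) = g i.
Proof. exact/facet_normal_exposed/frame_facet. Qed.

Lemma frame_vertex_in : S x. Proof. by have [_ _ []] := fr. Qed.

Lemma frame_dual i j : dot (N (g i)) (d j) = (i == j)%:R.
Proof. by have [_ _ [_ bd _]] := fr; exact: bd. Qed.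

Lemma face_normal_frame F : F x -> U F = \sum_(i | `[< F `<=` g i >]) N (g i).
Proof.
move=> Fx; have [gI gP _] := fr; rewrite /face_normal.
have -> : [set G | facet S G /\ F `<=` G] =
    [set` [seq g i | i <- enum 'I_n & `[< F `<=` g i >]]].
  apply/seteqP; split=> G /=.
    move=> [fG FG]; have [i iG] : exists i, g i = G by apply/gP; split=> //;
      exact: FG.
    apply/mapP; exists i => //; rewrite mem_filter mem_enum andbT.
    by apply/asboolP; rewrite iG.
  move=> /mapP[i + ->]; rewrite mem_filter => /andP[/asboolP Fi _].
  by split=> //; exact: frame_facet.
rewrite -fsbig_seq; last first.
  by rewrite map_inj_uniq// filter_uniq// enum_uniq.
by rewrite big_map big_filter big_enum_cond.
Qed.

Lemma face_normal_dual F i : F x -> dot (U F) (d i) = `[< F `<=` g i >]%:R.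
Proof.
move=> Fx; rewrite face_normal_frame// dot_suml.
have [Fi|Fi] := boolP `[< F `<=` g i >].
  rewrite (bigD1 i)//= frame_dual eqxx big1 ?addr0// => j /andP[_ ji].
  by rewrite frame_dual (negPf ji).
rewrite big1// => j Fj; rewrite frame_dual; case: eqP => // ji.
by rewrite -ji Fj in Fi.
Qed.

Lemma exposed_facet_sum (P : pred 'I_n) :
  exposed S (\sum_(i | P i) N (g i)) = S `&` [set y | forall i, P i -> g i y].
Proof.
have gx i : P i -> exposed S (N (g i)) x.
  by move=> _; rewrite frame_exposed; exact: frame_in.
apply/seteqP; split=> y.
  move=> yP; split=> [|i Pi]; first exact: exposed_sub yP.
  by rewrite -frame_exposed; exact: (exposed_sumI frame_vertex_in gx yP).
by move=> [Sy gy]; apply: exposed_sum => // i Pi; rewrite frame_exposed;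
  exact: gy.
Qed.

(** The edge leaving [x] along [d i] stays on all the other facets of the frame but leaves [g i]. *)
Lemma facet_meet_sub (P : pred 'I_n) i :
  S `&` [set y | forall i, P i -> g i y] `<=` g i <-> P i.
Proof.
split=> [sub|Pi y [_]]; last exact.
apply: contrapT => nPi; have [_ _ Sx] := fr.
have [y [t [t0 vy yE _]]] := simplicial_edge i Sf Sx.
have : g i y.
  apply: sub; split=> [|j Pj]; first exact: vertex_in.
  have ji : j != i by apply: contra_notN nPi => /eqP <-.
  have gx := frame_in j; rewrite -frame_exposed in gx *.
  apply: (exposedE gx); first exact: vertex_in.
  by rewrite yE !dotE frame_dual (negPf ji) mulr0 addr0.
rewrite -frame_exposed => /exposed_eq; have := frame_in i.
rewrite -{1}frame_exposed => gx /(_ _ gx);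
  rewrite yE !dotE frame_dual eqxx mulr1.
by move=> /eqP; rewrite addrC -subr_eq0 addrK gt_eqF.
Qed.

End Frame.

(** A functional exposing [F] is a conic combination of normals of facets containing [F], so [F] is
    the intersection of these facets, and that is what their sum exposes. *)
Lemma face_normal_exposed F : nonempty_proper_face S F -> exposed S (U F) = F.
Proof.
move=> /(nonempty_proper_faceP F Sf hfull)[v v0 FE].
have [x vx ux] := finite_hull_vertex v Sf.
have [g [d fr]] := vertex_frame_exists vx; have [gI gP Sx] := fr.
have Fx : F x by rewrite FE.
rewrite (face_normal_frame fr)// (exposed_facet_sum fr).
apply/seteqP; split=> y; last first.
  move=> Fy; split=> [|i /asboolP]; last exact.
  by move: Fy; rewrite FE; exact: exposed_sub.
move=> [Sy gy]; rewrite FE.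
have [k [G [c [fG vG c0 vE]]]] := facet_conic Sf hfull facet_normal_exposed ux.
rewrite vE; apply: exposed_sum => // i _; apply: exposedZ => //.
rewrite facet_normal_exposed//.
have [j jG] : exists j, g j = G i by apply/gP; split=> //; exact: vG.
by rewrite -jG; apply: gy; apply/asboolP; rewrite jG FE.
Qed.

Lemma face_normal_neq0 F : nonempty_proper_face S F -> U F <> 0.
Proof.
move=> pF U0; have := face_normal_exposed pF; rewrite U0 exposed0 => SF.
by have [[_ [_ H]] _] := pF; apply: H; rewrite -SF.
Qed.

Lemma face_normal_lattice F : finite_set [set G | facet S G] ->
  dual_lattice L (U F).
Proof.
move=> fin; rewrite /face_normal fsbig_finite; last first.
  by apply: sub_finite_set fin => G [].
rewrite big_seq; apply: dual_lattice_sum => G.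
rewrite in_fset_set; last by apply: sub_finite_set fin => G' [].
by rewrite inE => -[/facet_normalP[_ []]].
Qed.

Lemma proper_face_facet F x g d :
  vertex_frame x g d -> nonempty_proper_face S F ->
  F x -> exists i, F `<=` g i.
Proof.
move=> fr pF Fx; have [v v0 FE] := (nonempty_proper_faceP F Sf hfull).1 pF.
have [G fG vG] := exposed_sub_facet Sf hfull v0; have [_ gP _] := fr.
have [i iG] : exists i, g i = G by apply/gP; split=> //; apply: vG; rewrite -FE.
by exists i; rewrite iG FE.
Qed.

End VertexFrames.

(** * Omnitruncations *)
Section Omnitruncation.
Variables (R : realType) (n : nat) (L S : set 'rV[R]_n).
Hypotheses (hL : lattice L) (hS : polytope L S) (hfull : full_dim S).
Hypothesis hsimple : simple S.
Local Notation V := 'rV[R]_n.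
Local Notation N := (facet_normal L S).
Local Notation U := (face_normal L S).
Implicit Types (u v w x y z : V) (F G : set V) (g : 'I_n -> set V).

Let Sf : finite_hull S := polytope_finite_hull hS.

(** Decreasing in [i]: for a frame, index 0 gives a facet and the last index the vertex. Cutting
    smaller faces first thus consumes a flag from its high indices down. *)
Definition flag_face g (i : 'I_n) : set V :=
  S `&` [set y | forall l : 'I_n, (l <= i)%N -> g l y].

Section Flags.
Variables (x : V) (g : 'I_n -> set V) (d : 'I_n -> V).
Hypothesis fr : vertex_frame L S x g d.

Lemma flag_face_sub i j : flag_face g i `<=` g j <-> (j <= i)%N.
Proof. exact: (facet_meet_sub hL hS hfull fr (fun l : 'I_n => (l <= i)%N)). Qed.

Lemma flag_face_in i : flag_face g i x.
Proof. by split; [exact: frame_vertex_in fr|move=> l _;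
  exact: frame_in fr _]. Qed.

Lemma flag_normal i : U (flag_face g i) = \sum_(l : 'I_n | (l <= i)%N) N (g l).
Proof.
rewrite (face_normal_frame fr (flag_face_in i)); apply: eq_bigl => l.
by apply/asboolP/idP => /flag_face_sub.
Qed.

Lemma flag_normal_dual i j : dot (U (flag_face g i)) (d j) = (j <= i)%N%:R.
Proof.
rewrite (face_normal_dual fr _ (flag_face_in i)); congr (_%:R).
by congr nat_of_bool; apply/asboolP/idP => /flag_face_sub.
Qed.

Lemma flag_face_exposed i : exposed S (U (flag_face g i)) = flag_face g i.
Proof. by rewrite flag_normal (exposed_facet_sum hL hS hfull fr). Qed.

Lemma flag_face_proper i : nonempty_proper_face S (flag_face g i).
Proof.
apply/nonempty_proper_faceP => //; exists (U (flag_face g i)).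
  move=> U0; have := flag_normal_dual i i; rewrite U0 dot0l leqnn => /eqP.
  by rewrite eq_sym oner_eq0.
by rewrite flag_face_exposed.
Qed.

Lemma vertex_frame_perm (s : {perm 'I_n}) :
  vertex_frame L S x (g \o s) (d \o s).
Proof.
have [gI gP [Sx bd xP]] := fr; split.
- exact: inj_comp gI (@perm_inj _ s).
- move=> G; rewrite -gP; split=> -[i <-]; first by exists (s i).
  by exists (s^-1%g i); rewrite /= permKV.
- split=> // [i j|u]; first by rewrite /= bd /= (inj_eq perm_inj).
  rewrite xP; split=> h i; first exact: h.
  by have := h (s^-1%g i); rewrite /= permKV.
Qed.

End Flags.

Lemma simplicial_perm Q z b d (s : {perm 'I_n}) : simplicial Q z b d ->
  simplicial Q z (b \o s) (d \o s).
Proof.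
move=> [Qz bd zP]; split=> // [i j|u]; first by rewrite /= bd (inj_eq perm_inj).
rewrite zP; split=> h i; first exact: h.
by have := h (s^-1%g i); rewrite /= permKV.
Qed.

Lemma flag_face_tperm g (j i0 i : 'I_n) : (j <= i0 <= i)%N ->
  flag_face (g \o tperm j i0) i = flag_face g i.
Proof.
move=> /andP[ji0 i0i].
have tle (l : 'I_n) : (l <= i)%N -> (tperm j i0 l <= i)%N.
  by case: tpermP => // -> _; apply: leq_trans i0i.
apply/seteqP; split=> y [Sy yP]; split=> // l li; last exact/yP/tle.
by have := yP _ (tle _ li); rewrite /= tpermK.
Qed.

Lemma depth_neighbor Q F u : 0 < depth Q F u -> exists y, neighbor Q F y.
Proof.
move=> dpos; apply: contrapT => H; move: dpos; rewrite /depth.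
have -> : neighbor Q F = set0 by apply/seteqP; split=> // y Ny; apply: H;
  exists y.
(* The infimum of the empty set is 0 by default, so positive depth rules out the absence of
   neighbors. *)
by rewrite image_set0 inf0 ltxx.
Qed.

(** * Vertices and normal cones of the successive truncations *)

Section Listing.
Variables (fs : seq (set V)) (eps : set V -> R).
Hypothesis hfs : face_listing S fs.
Hypothesis heps : forall i, (i < size fs)%N ->
  let F := nth set0 fs i in let Q := omni L S fs eps i in
  shallow Q (F `&` Q) (U F) (eps F).

Lemma listing_index_lt F : nonempty_proper_face S F -> (index F fs < size fs)%N.
Proof. by have [_ fsP _] := hfs; move=> /fsP; rewrite index_mem. Qed.

Lemma listing_index_inj F G : nonempty_proper_face S F ->
  nonempty_proper_face S G -> index F fs = index G fs -> F = G.
Proof.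
have [_ fsP _] := hfs; move=> /fsP Ff /fsP Gf FG.
by rewrite -(nth_index set0 Ff) FG nth_index.
Qed.

Lemma listing_index_le F G : nonempty_proper_face S F ->
  nonempty_proper_face S G -> F `<=` G -> (index F fs <= index G fs)%N.
Proof.
move=> pF pG FG; have [_ fsP fsI] := hfs.
apply: fsI; [exact: listing_index_lt..|].
by rewrite !nth_index//; exact/fsP.
Qed.

(* The normal cone of the [k]-th step at [z]: the first [m] facet normals have
   survived, the others were replaced by normals of truncated flag faces. *)
Definition stage_basis g m (i : 'I_n) : V :=
  if (i < m)%N then N (g i) else U (flag_face g i).

(** The last clause pins [m] down: the flag face of index [m - 1] is still to be cut. Once the
    listing is exhausted this forces [m = 0]. *)
Definition stage_vertex k z := exists x g d m d',
  [/\ vertex S x, vertex_frame L S x g d,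
      simplicial (omni L S fs eps k) z (stage_basis g m) d',
      (m <= n)%N & forall i : 'I_n,
        [/\ (i < m)%N -> g i z,
            (m <= i)%N -> (index (flag_face g i) fs < k)%N &
            i.+1 = m -> (k <= index (flag_face g i) fs)%N]].

Lemma stage_basis_dual x g d m i l : vertex_frame L S x g d ->
  dot (stage_basis g m i) (d l) = (if (i < m)%N then i == l else l <= i)%N%:R.
Proof.
move=> fr; rewrite /stage_basis; case: ifP => _; first exact: frame_dual fr _ _.
exact: (flag_normal_dual fr).
Qed.

Lemma face_frame x g d F : vertex_frame L S x g d -> nonempty_proper_face S F ->
  F x -> F = S `&` [set y | forall i, F `<=` g i -> g i y].
Proof.
move=> fr pF Fx; rewrite -{1}(face_normal_exposed hL hS hfull hsimple pF).
rewrite (face_normal_frame fr Fx) (exposed_facet_sum hL hS hfull fr).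
by congr (_ `&` _); apply/seteqP; split=> y /= yP i Fi; apply: yP;
  exact/asboolP.
Qed.

(** The face cut next and minimized at [z] must be the next one of the flag at [z]. Pairing the
    expansion of [U F] in the stage basis with the [d l] gives, by nonnegativity of the
    coefficients, constraints on the set of facets containing [F]. *)
Lemma stage_flag k z x g d m d' F : vertex_frame L S x g d ->
  simplicial (omni L S fs eps k) z (stage_basis g m) d' ->
  (forall i : 'I_n, (m <= i)%N -> (index (flag_face g i) fs < k)%N) ->
  (forall i : 'I_n, i.+1 = m -> (k <= index (flag_face g i) fs)%N) ->
  (m <= n)%N ->
  nonempty_proper_face S F -> index F fs = k ->
  exposed (omni L S fs eps k) (U F) z ->
  exists2 i0 : 'I_n, i0.+1 = m & F = flag_face g i0.
Proof.
move=> fr [Qz bd zP] mle mgt mn pF Fk Fz.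
pose c i := dot (U F) (d' i).
have c0 i : 0 <= c i by exact: (zP _).1.
have UE : U F = \sum_i c i *: stage_basis g m i by exact: dual_expand.
have Fx : F x.
  rewrite -(face_normal_exposed hL hS hfull hsimple pF) UE.
  apply: exposed_sum => [|i _]; first exact: frame_vertex_in fr.
  apply: exposedZ => //; rewrite /stage_basis; case: ifP => _.
    by rewrite (frame_exposed hL hS hfull fr); exact: frame_in fr _.
  by rewrite (flag_face_exposed fr); exact: flag_face_in fr _.
have FE := face_frame fr pF Fx.
pose P l := `[< F `<=` g l >].
have dl l : (P l)%:R =
    \sum_i c i * (if (i < m)%N then i == l else l <= i)%N%:R :> R.
  rewrite -(face_normal_dual fr l Fx) UE dot_suml; apply: eq_bigr => i _.
  by rewrite dotZl (stage_basis_dual _ _ _ fr).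
have cle (l i : 'I_n) :
  (if (i < m)%N then i == l else l <= i)%N -> c i <= (P l)%:R.
  move=> il; rewrite dl (bigD1 i)//= il mulr1 lerDl sumr_ge0// => k' _.
  by rewrite mulr_ge0.
(* If some facet of index at least [m] contains [F], let [l0] be the largest such index. Its
   coefficient is positive, so all facets of smaller index contain [F] too and [F] is
   [flag_face g l0], which has already been cut. *)
have [[l1 l1m]|H] := pselect (exists2 l : 'I_n, (m <= l)%N & P l).
  move=> Pl1; have [l0 /andP[ml0 Pl0] l0P] := @arg_maxnP _ l1
    (fun l : 'I_n => (m <= l)%N && P l) (fun l => l :
      nat) (introT andP (conj l1m Pl1)).
  exfalso; have cgt (i : 'I_n) : (l0 < i)%N -> c i = 0.
    move=> l0i; apply/le_anti; rewrite c0 andbT; apply: le_trans (cle i i _) _.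
      by rewrite eqxx leqnn if_same.
    have [Pi|] := boolP (P i); last by [].
    have : (i <= l0)%N by apply: l0P;
      rewrite Pi andbT (leq_trans ml0 (ltnW l0i)).
    by rewrite leqNgt l0i.
  have cl0 : 0 < c l0.
    rewrite lt_neqAle c0 andbT; apply/eqP => cl0; have := dl l0.
    rewrite Pl0 big1 => [/eqP|i _]; first by rewrite oner_eq0.
    case: ltnP => im.
      case: eqP => [il|_]; last by rewrite mulr0.
      by move: im; rewrite il ltnNge ml0.
    case: (leqP l0 i) => [|_]; last by rewrite mulr0.
    rewrite leq_eqVlt => /orP[/eqP/val_inj <-|/cgt ->]; last by rewrite mul0r.
    by rewrite -cl0 mul0r.
  have PE (l : 'I_n) : P l = (l <= l0)%N.
    apply/idP/idP => [Pl|ll0].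
      case: (leqP m l) => [ml|lm]; last exact: leq_trans (ltnW lm) ml0.
      by apply: l0P; rewrite ml Pl.
    have := cle l l0; rewrite ltnNge ml0 /= => /(_ ll0) => /(lt_le_trans cl0).
    by case: (P l); rewrite ?ltxx.
  have FE' : F = flag_face g l0.
    rewrite FE; congr (_ `&` _); apply/seteqP; split=> y /= yP l.
      by rewrite -PE => /asboolP; exact: yP.
    by move=> /asboolP Pl; apply: yP; rewrite -PE.
  by have := mle l0 ml0; rewrite -FE' Fk ltnn.
have [i Fi] := proper_face_facet hS hfull fr pF Fx.
have lm (l : 'I_n) : F `<=` g l -> (l < m)%N.
  move=> Fl; rewrite ltnNge; apply/negP => ml; apply: H; exists l => //.
  exact/asboolP.
have m0 : (0 < m)%N by exact: leq_ltn_trans (lm i Fi).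
have im : (m.-1 < n)%N by rewrite prednK.
exists (Ordinal im); first by rewrite /= prednK.
(* In the remaining case this inclusion and the listing order put the flag face no later than [F],
   and the invariant puts it no earlier. *)
have sub : flag_face g (Ordinal im) `<=` F.
  rewrite FE => y [Sy yP]; split=> // l /lm lm'; apply: yP.
  by rewrite /= -ltnS prednK.
apply: listing_index_inj => //; first exact: flag_face_proper fr _.
apply/eqP; rewrite eqn_leq [X in _ && X]listing_index_le//; last first.
  exact: flag_face_proper fr _.
by rewrite Fk andbT mgt//= prednK.
Qed.

(** Shallowness is stated for the intersection of [F] with the stage, the depth lemmas for the
    exposed face. They agree because a minimizing vertex of the stage lies on [F], so that [U F] has
    the same minimum on the stage as on [S]. *)
Lemma stage_exposed k F : simple_hull (omni L S fs eps k) ->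
  omni L S fs eps k `<=` S ->
  (forall z, vertex (omni L S fs eps k) z -> stage_vertex k z) ->
  nonempty_proper_face S F -> index F fs = k ->
  exposed (omni L S fs eps k) (U F) = F `&` omni L S fs eps k.
Proof.
set Q := omni L S fs eps k => -[Qf _] QS Qv pF Fk.
have [z vz uz] := finite_hull_vertex (U F) Qf.
have [x [g [d [m [d' [vx fr Sz mn H]]]]]] := Qv z vz.
have [||i0 i0m FE] := stage_flag fr Sz _ _ mn pF Fk uz.
- by move=> i; have [] := H i.
- by move=> i; have [] := H i.
have Fz : exposed S (U F) z.
  rewrite (face_normal_exposed hL hS hfull hsimple pF) FE; split.
    by apply: QS; exact: vertex_in.
  by move=> l li0; have [+ _ _] := H l; apply; rewrite -i0m ltnS.
rewrite -[in RHS](face_normal_exposed hL hS hfull hsimple pF).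
apply/seteqP; split=> y.
  move=> uy; split; last exact: exposed_sub uy.
  apply: (exposedE Fz); first by apply: QS; exact: exposed_sub uy.
  exact: exposed_eq uy uz.
by move=> [Fy Qy]; apply: (exposedE uz) => //; exact: exposed_eq Fy Fz.
Qed.

Lemma omniS k : (k < size fs)%N -> omni L S fs eps k.+1 =
  trunc (omni L S fs eps k) (U (nth set0 fs k)) (eps (nth set0 fs k)).
Proof. by move=> ks; rewrite /omni (take_nth set0 ks) foldl_rcons. Qed.

Lemma stage_invariant k : (k <= size fs)%N ->
  [/\ simple_hull (omni L S fs eps k), omni L S fs eps k `<=` S &
      forall z, vertex (omni L S fs eps k) z -> stage_vertex k z].
Proof.
elim: k => [|k IH] ks.
  rewrite /omni take0 /=; split=> //;
    first exact: (simple_hullS hL hS hfull hsimple).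
  move=> z vz; have [g [d fr]] := vertex_frame_exists hL hS hfull hsimple vz.
  exists z, g, d, n, d; split=> //.
    have [_ _ Sz] := fr; rewrite /omni take0 /=.
    suff -> : stage_basis g n = N \o g by [].
    by apply/funext => i; rewrite /stage_basis ltn_ord.
  move=> i; split=> // [_|]; first exact: frame_in fr _.
  by rewrite leqNgt ltn_ord.
have [Qs QS Qv] := IH (ltnW ks); have [fsU fsP fsI] := hfs.
set Q := omni L S fs eps k in Qs QS Qv *.
set F := nth set0 fs k.
have pF : nonempty_proper_face S F by apply/fsP; exact: mem_nth.
have Fk : index F fs = k by exact: index_uniq.
have QF := stage_exposed Qs QS Qv pF Fk; rewrite -/Q in QF.
have := heps ks; rewrite -/F -/Q /= -QF => /andP[e0 ed].
have Qf := Qs.1; have Qc := finite_hull_convex Qf.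
set c := supp Q (U F) + eps F.
have QSE : omni L S fs eps k.+1 = cut Q (U F) c by rewrite omniS.
(* Shallowness keeps the hyperplane strictly between the cut face and all other vertices, so new
   vertices lie inside edges leaving the face. *)
have far y : vertex Q y -> ~ exposed Q (U F) y -> c < dot (U F) y.
  by move=> vy uy; have := depth_le_vertex Qs vy uy; rewrite /c; lra.
have Tf : finite_hull (cut Q (U F) c).
  have [y [vy uy _]] := depth_neighbor (lt_trans e0 ed).
  apply: (finite_hull_cut Qf (vertex_in vy)); exact/ltW/far.
have near y : exposed Q (U F) y -> dot (U F) y < c.
  by move=> uy; rewrite /c (supp_exposed uy) ltrDl.
suff Tv z : vertex (omni L S fs eps k.+1) z -> stage_vertex k.+1 z.
  split=> //; last by rewrite QSE => y [/QS].
  split=> [|z /Tv[x [g [d [m [d' [_ _ Sz _ _]]]]]]]; first by rewrite QSE.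
  by exists (stage_basis g m), d'.
rewrite QSE => vz; have [Qz /= cz] := vertex_in vz.
have [cz'|zc] := ltP c (dot (U F) z).
  have vQz : vertex Q z by exact: vertex_cut_interior vz cz'.
  have [x [g [d [m [d' [vx fr Sz mn H]]]]]] := Qv z vQz.
  have [_ bd zP] := Sz.
  exists x, g, d, m, d'; split=> // [|i].
    rewrite QSE; split=> // u; rewrite -zP; split.
      exact: exposed_cut_interior Qc (vertex_in vz) cz'.
    by move=> uz; apply: (exposedS _ uz) => //; exact: cut_sub.
  have [H1 H2 H3] := H i; split=> // [/H2/ltnW//|im].
  (* If [F] were the next flag face at [z], then [z] would lie on [F] and be cut off. *)
  rewrite ltn_neqAle H3// andbT; apply/eqP => kE.
  have FE : F = flag_face g i.
    by apply: listing_index_inj => //;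
      [exact: flag_face_proper fr _|rewrite Fk kE].
  have : exposed Q (U F) z.
    rewrite QF; split=> //; rewrite FE; split; first exact: QS.
    by move=> l li; have [+ _ _] := H l; apply; rewrite -im ltnS.
  by move=> /near; rewrite ltNge cz.
have {zc} zc : dot (U F) z = c by apply/le_anti; rewrite zc cz.
have [|a [b [ab va vb /andP[ac cb] [t /andP[t0 t1] zE]]]] :=
  vertex_cut_boundary Qf vz zc.
  move=> vQz; have [/near|/(far z vQz)] := pselect (exposed Q (U F) z);
  by rewrite zc ltxx.
have ua : exposed Q (U F) a.
  by apply: contrapT => /(far a va); rewrite ltNge (ltW ac).
have [x [g [d [m [d' [vx fr Sa mn H]]]]]] := Qv a va.
have [||i0 i0m FE] := stage_flag fr Sa _ _ mn pF Fk ua.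
- by move=> i; have [] := H i.
- by move=> i; have [] := H i.
have [j [r [r0 bE]]] := edge_direction Qf Sa ab.
have uj : 0 < dot (U F) (d' j).
  by move: (lt_trans ac cb); rewrite bE !dotE ltrDl pmulr_rgt0.
have [_ bd aP] := Sa.
(* [U F] is the sum of the first [i0 + 1] surviving facet normals and increases along [d' j], so the
   edge leaves one of these facets. *)
have ji0 : (j <= i0)%N.
  rewrite leqNgt; apply/negP => i0j; move: uj.
  rewrite FE (flag_normal fr) dot_suml big1 ?ltxx// => l li0.
  have := bd l j; rewrite /stage_basis -i0m ltnS li0 => ->.
  by case: eqP => // lj; move: li0; rewrite lj leqNgt i0j.
have zE' : z = a + (t * r) *: d' j by rewrite zE bE [a + r *:
  _]addrC addrK scalerA.
have trr : 0 < t * r < r by rewrite mulr_gt0// gtr_pMl.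
have := simplicial_cut (u := U F) (c := c) (j := j) Qf Sa trr; rewrite -bE -zE'.
move=> /(_ (vertex_in vb) uj zc)[d'' Tz].
(* The facet that is left moves to position [i0], where [U F] takes over; flag faces from [i0] on
   are unaffected by the swap. *)
pose s := tperm j i0.
exists x, (g \o s), (d \o s), i0, (d'' \o s); split=> //.
- exact: vertex_frame_perm.
- have := simplicial_perm s Tz; rewrite QSE.
  suff -> : (fun i => if i == j then U F else stage_basis g m i) \o s =
      stage_basis (g \o s) i0 by [].
  apply/funext => i /=; rewrite -(inj_eq (@perm_inj _ s)) tpermK /s tpermL.
  rewrite /stage_basis -i0m; case: (ltngtP i i0) => [ii0|i0i|/val_inj ->].
  + rewrite (_ : i == i0 = false); last by apply/eqP => ii0';
    rewrite ii0' ltnn in ii0.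
    by rewrite ltnS /=; case: tpermP => _; rewrite ?leqnn ?ji0 ?(ltnW ii0).
  + rewrite (_ : i == i0 = false); last by apply/eqP => ii0';
    rewrite ii0' ltnn in i0i.
    rewrite tpermD; last 2 first.
    * by apply/eqP => ji; move: ji0; rewrite ji leqNgt i0i.
    * by apply/eqP => i0i'; rewrite i0i' ltnn in i0i.
    by rewrite ltnS leqNgt i0i /= flag_face_tperm// ji0 ltnW.
  + by rewrite eqxx flag_face_tperm ?ji0 ?leqnn// -FE.
- by rewrite -ltnS i0m ltnW.
move=> i; split=> [ii0|i0i|i1].
- have si : (s i <= i0)%N.
    by rewrite /s; case: tpermP => // _ _; exact: ltnW.
  have sij : s i != j.
    apply/eqP => sij; have : i = i0.
      by apply: (@perm_inj _ s); rewrite sij /s tpermR.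
    by move=> ii0'; rewrite ii0' ltnn in ii0.
  have [gz _ _] := H (s i); have := gz _; rewrite -i0m ltnS => /(_ si).
  rewrite /= -(frame_exposed hL hS hfull fr) => ga.
  apply: (exposedE ga); first exact: QS.
  have := bd (s i) j; rewrite (negPf sij) /stage_basis -i0m ltnS si => h.
  by rewrite zE' dotDr dotZr h mulr0 addr0.
- rewrite flag_face_tperm ?ji0//; move: i0i; rewrite leq_eqVlt.
  move=> /predU1P[/val_inj <-|i0i]; first by rewrite -FE Fk.
  by have [_ + _] := H i; rewrite -i0m => /(_ i0i) /ltnW.
(* The new flag face before position [i0] contains [F] strictly, since it is not inside the facet at
   [i0]; hence it is listed strictly later. *)
- have fr' := vertex_frame_perm fr s.
  have FE' : F = flag_face (g \o s) i0 by rewrite flag_face_tperm ?ji0 ?leqnn.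
  have sub : F `<=` flag_face (g \o s) i.
    rewrite FE' => y [Sy yP]; split=> // l li; apply: yP.
    by rewrite (leq_trans li)// -i1.
  have pfl := flag_face_proper fr' i.
  have := listing_index_le pF pfl sub; rewrite Fk leq_eqVlt => /predU1P[kE|//].
  have FE2 : F = flag_face (g \o s) i by apply: listing_index_inj => //;
    rewrite Fk.
  have : flag_face (g \o s) i `<=` (g \o s) i0.
    by rewrite -FE2 FE'; apply/(flag_face_sub fr').
  by move=> /(flag_face_sub fr'); rewrite -i1 ltnn.
Qed.

End Listing.

Lemma omnitruncation_cones P : omnitruncation L S P ->
  finite_hull P /\ forall z, vertex P z -> exists x g d d',
    [/\ vertex S x, vertex_frame L S x g d &
        simplicial P z (fun i => U (flag_face g i)) d'].
Proof.
move=> [fs [eps [hfs heps ->]]].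
have [[Pf _] _ Pv] := stage_invariant hfs heps (leqnn _).
split=> // z /Pv[x [g [d [m [d' [vx fr Sz mn H]]]]]].
suff m0 : m = 0%N.
  exists x, g, d, d'; split=> //; move: Sz; rewrite m0.
  by congr (simplicial _ _ _ _).
apply/eqP; rewrite -leqn0 leqNgt; apply/negP => m0.
have im : (m.-1 < n)%N by rewrite prednK.
have [_ _ /=] := H (Ordinal im); rewrite prednK// => /(_ erefl).
by rewrite leqNgt (listing_index_lt hfs)//; exact: flag_face_proper fr _.
Qed.

End Omnitruncation.

(** * Deformations and truncations *)
Section Deformations.
Variables (R : realType) (n : nat) (L S P : set 'rV[R]_n).
Hypotheses (hL : lattice L) (hS : polytope L S) (hfull : full_dim S).
Hypotheses (hsimple : simple S) (hP : omnitruncation L S P).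
Local Notation V := 'rV[R]_n.
Local Notation N := (facet_normal L S).
Local Notation U := (face_normal L S).
Implicit Types (u v w x y z : V) (F G Q : set V) (g : 'I_n -> set V).

Let Sf : finite_hull S := polytope_finite_hull hS.

Lemma facet_finite : finite_set [set G | facet S G].
Proof.
have [fs [eps [[_ fsP _] _ _]]] := hP.
by apply: (@sub_finite_set _ _ [set` fs]) => // G [/fsP].
Qed.

Lemma face_normal_dual_lattice F : dual_lattice L (U F).
Proof. exact/(face_normal_lattice hL hS hfull)/facet_finite. Qed.

Lemma nconeP Q G v : finite_hull Q -> G `<=` Q ->
  ncone Q G v <-> G `<=` exposed Q v.
Proof.
move=> Qf GQ; have [z _ vz] := finite_hull_vertex v Qf.
split=> H x Gx; last by rewrite (supp_exposed (H x Gx)).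
by apply: (exposedE vz); [exact: GQ|rewrite -(supp_exposed vz) H].
Qed.

Definition flag_minimized Q q g :=
  Q q /\ forall i, exposed Q (U (flag_face S g i)) q.

(** A cone of the fan lies in the cone of a vertex, generated by the normals of one flag; whatever
    minimizes these normals minimizes the whole cone. *)
Lemma nfan_flag sigma : nfan P sigma -> exists x g d,
  [/\ vertex S x, vertex_frame L S x g d &
    forall Q q u, flag_minimized Q q g -> sigma u -> exposed Q u q].
Proof.
have [Pf Pv] := omnitruncation_cones hL hS hfull hsimple hP.
move=> [G [+ [y Gy]] <-] => -[G0|[w GE]]; first by rewrite G0 in Gy.
have [z vz wz] := finite_hull_vertex w Pf.
have [x [g [d [d' [vx fr [_ bd zP]]]]]] := Pv z vz.
exists x, g, d; split=> // Q q u [Qq Qm].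
move=> /nconeP - /(_ Pf);
  rewrite GE => /(_ (@exposed_sub _ _ _ _)) /(_ z wz) /zP ud.
rewrite (dual_expand u bd); apply: exposed_sum => // i _.
exact: exposedZ.
Qed.

Lemma nfan_cover u : nfan P (ncone P (exposed P u)) /\ ncone P (exposed P u) u.
Proof.
have [Pf Pv] := omnitruncation_cones hL hS hfull hsimple hP.
have [z vz uz] := finite_hull_vertex u Pf; split.
  exists (exposed P u) => //; split; last by exists z.
  by right; exists u.
by apply/(nconeP u Pf); [exact: exposed_sub|].
Qed.

Lemma ncone_flag u : exists x g d, [/\ vertex S x, vertex_frame L S x g d &
  exists c : 'I_n -> R, (forall i, 0 <= c i) /\
    u = \sum_i c i *: U (flag_face S g i)].
Proof.
have [Pf Pv] := omnitruncation_cones hL hS hfull hsimple hP.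
have [z vz uz] := finite_hull_vertex u Pf.
have [x [g [d [d' [vx fr [_ bd zP]]]]]] := Pv z vz.
exists x, g, d; split=> //; exists (fun i => dot u (d' i)).
by split; [exact/zP|exact: dual_expand].
Qed.

(** * A criterion for deformations *)

Section Criterion.
Variable Q : set V.
Hypotheses (Qf : finite_hull Q)
  (Qflag : forall x g d, vertex S x -> vertex_frame L S x g d ->
     exists q, flag_minimized Q q g).

Lemma supp_PL : PL (nfan P) (supp Q).
Proof.
move=> sigma /nfan_flag[x [g [d [vx fr H]]]].
have [q Qq] := Qflag vx fr; exists q => u su.
exact/supp_exposed/(H Q q u Qq su).
Qed.

(** It suffices that a normal cone of [Q] containing [u] contains the whole smallest cone of the fan
    of [P] around [u]. *)
Lemma coarsens_nfan : coarsens (nfan Q) (nfan P).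
Proof.
have [Pf Pv] := omnitruncation_cones hL hS hfull hsimple hP.
move=> sigma [F [[F0|[w FE]] [y Fy]] <-]; first by rewrite F0 in Fy.
exists [set tau | nfan P tau /\ tau `<=` ncone Q F] => [tau []//|].
apply/seteqP; split=> u; last by move=> [tau [_ tF] /tF].
move=> uF; have FQ : F `<=` Q by rewrite FE; exact: exposed_sub.
have {}uF := (nconeP u Qf FQ).1 uF.
have [fan uu] := nfan_cover u.
exists (ncone P (exposed P u)) => //; split=> // v vu.
apply/(nconeP v Qf FQ) => p Fp.
(* As [u] is relatively interior to its own cone, it splits inside the cone as [e *: v] plus a
   remainder. Both are minimized at the same point of [Q], so minimizers of [u] minimize [v]. *)
have [e e0 E] := finite_hull_exposed2 u (- v) Pf.
have vu' := (nconeP v Pf (@exposed_sub _ _ _ _)).1 vu.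
have uev : ncone P (exposed P u) (u + e *: - v).
  apply/nconeP => //; first exact: exposed_sub.
  move=> z uz; rewrite E; split=> // z' uz'; rewrite !dotNl.
  by rewrite (exposed_eq (vu' z uz) (vu' z' uz')).
have [x [g [d [vx fr H]]]] := nfan_flag fan.
have [q Qq] := Qflag vx fr.
have vq := H Q q v Qq vu; have uevq := H Q q _ Qq uev.
rewrite -(exposedZ_eq Q v e0).
apply: (exposedD (exposedZ (ltW e0) vq) uevq).
by rewrite scalerN addrC subrK; exact: uF.
Qed.

(** Replacing the positive coefficients of a conic combination of jointly minimized normals by 1
    keeps the exposed face and makes the functional integral. *)
Lemma facet_rational G : facet Q G ->
  exists2 u, dual_lattice L u & G = exposed Q u.
Proof.
move=> [[[[->|[w GE]] _] [y Gy]] _]; first by [].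
have [x [g [d [vx fr [c [c0 wE]]]]]] := ncone_flag w.
have [q [Qq Qm]] := Qflag vx fr.
pose b i := U (flag_face S g i).
exists (\sum_(i | c i != 0) b i).
  by apply: dual_lattice_sum => i _; exact: face_normal_dual_lattice.
rewrite GE wE; apply/seteqP; split=> p pP.
  apply: exposed_sum => [|i ci]; first exact: exposed_sub pP.
  have ci0 : 0 < c i by rewrite lt_neqAle eq_sym ci c0.
  rewrite -(exposedZ_eq Q _ ci0).
  by apply: (exposed_sumI (P := xpredT) Qq _ pP) => // k _; exact: exposedZ.
rewrite (bigID (fun i => c i != 0))/= [X in _ + X]big1 ?addr0; last first.
  by move=> i /negPn/eqP ->; rewrite scale0r.
apply: exposed_sum => [|i ci]; first exact: exposed_sub pP.
by apply: exposedZ => //; apply: (exposed_sumI Qq _ pP) => // k _; exact: Qm.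
Qed.

Lemma deformation_flag : deformation L P Q.
Proof.
split; last exact: coarsens_nfan; have [s s0 QE] := Qf; split.
- by exists [set` s].
- by have [z /vertex_in Qz _] := finite_hull_vertex 0 Qf; exists z.
- exact: facet_rational.
Qed.

End Criterion.

Lemma PL_eq f1 f2 : PL (nfan P) f1 -> PL (nfan P) f2 ->
  (forall F, nonempty_proper_face S F -> f1 (U F) = f2 (U F)) -> f1 = f2.
Proof.
have [Pf Pv] := omnitruncation_cones hL hS hfull hsimple hP.
move=> f1P f2P f12; apply/funext => u.
have [z vz uz] := finite_hull_vertex u Pf.
have [x [g [d [d' [vx fr [Pz bd zP]]]]]] := Pv z vz.
have zn v : ncone P [set z] v <-> exposed P v z.
  rewrite nconeP//; last by move=> _ ->.
  by split=> [/(_ z erefl)//|? _ ->].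
have fan : nfan P (ncone P [set z]).
  by exists [set z] => //; split; [|exists z].
have [x1 f1x] := f1P _ fan; have [x2 f2x] := f2P _ fan.
rewrite (f1x u) ?(f2x u); [|exact/zn|exact/zn].
suff -> : x1 = x2 by [].
apply: (dual_inj bd) => i.
have bi : ncone P [set z] (U (flag_face S g i)).
  by apply/zn/zP => j; rewrite bd; case: eqP.
by rewrite -f1x// -f2x// f12//; exact: (flag_face_proper hL hS hfull fr).
Qed.

Lemma flag_minimized_vertex Q x g d : vertex_frame L S x g d -> Q `<=` S ->
  Q x -> flag_minimized Q x g.
Proof.
move=> fr QS Qx; split=> // i; apply: (exposedS QS) => //.
by rewrite (flag_face_exposed hL hS hfull fr); exact: (flag_face_in fr).
Qed.

(** * Truncations as deformations *)

Section Truncations.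
Variables (F : set V) (e : R).
Hypotheses (pF : nonempty_proper_face S F) (e0 : 0 < e) (eF : e <= delta L S F).
Local Notation T := (Tr L S F e).

Let FU : exposed S (U F) = F := face_normal_exposed hL hS hfull hsimple pF.
Let Ssimple : simple_hull S := simple_hullS hL hS hfull hsimple.

Lemma TrE : T = cut S (U F) (supp S (U F) + e).
Proof. by rewrite /Tr; case: asboolP => // F0; have [_ [x]] := pF;
  rewrite F0. Qed.

Lemma Tr_sub : T `<=` S. Proof. by rewrite TrE; exact: cut_sub. Qed.

Lemma delta_le_vertex y : vertex S y -> ~ F y ->
  delta L S F <= dot (U F) y - supp S (U F).
Proof. by rewrite /delta -{1 2}FU; exact: depth_le_vertex. Qed.

Lemma Tr_vertex y : vertex S y -> ~ F y -> T y.
Proof.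
move=> vy Fy; rewrite TrE; split; first exact: vertex_in.
by rewrite /= -lerBrDl; apply: le_trans (delta_le_vertex vy Fy).
Qed.

Lemma vertex_notin : exists2 y, vertex S y & ~ F y.
Proof.
have [y vy yP] := finite_hull_vertex (- U F) Sf; exists y => // Fy.
apply: (face_normal_neq0 hL hS hfull hsimple pF).
apply: (full_dim_exposed hfull) => z Sz; rewrite -FU in Fy.
apply: (exposedE Fy) => //; apply/le_anti; rewrite Fy.2// andbT.
by have := yP.2 z Sz; rewrite !dotNl lerN2.
Qed.

Lemma Tr_finite_hull : finite_hull T.
Proof.
have [y vy Fy] := vertex_notin; have := Tr_vertex vy Fy;
  rewrite TrE => -[Sy cy].
exact: finite_hull_cut cy.
Qed.

Section AtVertex.
Variables (x : V) (g : 'I_n -> set V) (d : 'I_n -> V) (j : 'I_n).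
Hypotheses (fr : vertex_frame L S x g d) (Fx : F x) (Fj : F `<=` g j).
Local Notation q := (x + e *: d j).

Lemma dot_face_normal_shift F' : F' x ->
  dot (U F') q = dot (U F') x + e * `[< F' `<=` g j >]%:R.
Proof. by move=> F'x; rewrite dotDr dotZr (face_normal_dual fr). Qed.

(** The edge along [d j] ends at a vertex outside [F], at height [t] above the minimum of [U F];
    since [e <= delta L S F <= t], the shifted point is still on it. *)
Lemma Tr_shift_in : T q.
Proof.
have [_ _ Sx] := fr; have [y [t [t0 vy yE _]]] := simplicial_edge j Sf Sx.
have Sy := vertex_in vy; have ux : exposed S (U F) x by rewrite FU.
have uy : dot (U F) y = supp S (U F) + t.
  rewrite yE !dotE (face_normal_dual fr _ Fx) (supp_exposed ux).
  by rewrite (asboolT Fj) mulr1.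
have et : e <= t.
  apply: (le_trans eF); have := @delta_le_vertex y vy; rewrite uy addrC addKr;
    apply.
  rewrite -FU => /supp_exposed E; have tE : t = 0.
    by apply: (addrI (supp S (U F))); rewrite -uy E addr0.
  by rewrite tE ltxx in t0.
rewrite TrE; split; last first.
  by rewrite /= dot_face_normal_shift// (asboolT Fj) mulr1 (supp_exposed ux).
have -> : q = x + (e / t) *: (y - x).
  by rewrite yE [x + t *: _]addrC addrK scalerA divfK// gt_eqF.
apply: (finite_hull_convex Sf) => //; first exact: frame_vertex_in fr.
by rewrite divr_ge0 ?ler_pdivrMr ?mul1r// ltW.
Qed.

(** If [F'] is not in [g j], the shift does not change [U F']. Otherwise [F'] lies in [F], so
    [U F' - U F] is still minimized at [x] over [S], while [U F] rises by at least [e] on the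
    truncation. *)
Lemma exposed_Tr_shift F' : nonempty_proper_face S F' -> F' x ->
  (F' `<=` g j -> F' `<=` F) -> exposed T (U F') q.
Proof.
move=> pF' F'x F'F; have ux : exposed S (U F) x by rewrite FU.
have u'x : exposed S (U F') x
  by rewrite (face_normal_exposed hL hS hfull hsimple).
split=> [|y Ty]; first exact: Tr_shift_in.
have Sy := Tr_sub Ty; rewrite dot_face_normal_shift//.
case: asboolP => [/F'F sub|_]; last by rewrite mulr0 addr0 u'x.2.
have [_ _ [_ _ xP]] := fr.
have [_ /(_ y Sy)] : exposed S (U F' - U F) x.
  apply/xP => l; rewrite dotBl !(face_normal_dual fr)// subr_ge0 ler_nat.
  case: (asboolP (F `<=` g l)) => // Fl; rewrite (_ : `[< _ >] = true)//.
  exact/asboolP/(subset_trans sub).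
move: Ty; rewrite TrE => -[_ /=]; rewrite (supp_exposed ux) !dotE; lra.
Qed.

End AtVertex.

Lemma Tr_flag_minimized x g d : vertex S x -> vertex_frame L S x g d ->
  flag_minimized T x g \/ exists j, flag_minimized T (x + e *: d j) g.
Proof.
move=> vx fr; have [Fx|Fx] := pselect (F x); last first.
  by left; apply: (flag_minimized_vertex (d := d)) => //;
    [exact: Tr_sub|exact: Tr_vertex].
have [i Fi] := proper_face_facet hS hfull fr pF Fx.
(* With the largest index [j] of a facet containing [F], any flag face inside [g j] lies in all
   facets containing [F], hence in [F]. *)
have [j /asboolP Fj jP] := @arg_maxnP _ i (fun l => `[< F `<=` g l >])
  (fun l => l : nat) (asboolT Fi).
right; exists j; split=> [|k]; first exact: Tr_shift_in fr Fx Fj.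
apply: (exposed_Tr_shift fr Fx Fj).
- exact: (flag_face_proper hL hS hfull fr).
- exact: flag_face_in fr _.
move=> /(flag_face_sub hL hS hfull fr) jk.
rewrite (face_frame hL hS hfull hsimple fr pF Fx) => y [Sy yP]; split=> // l Fl.
by apply: yP; apply: leq_trans jk; apply: jP; exact/asboolP.
Qed.

Lemma supp_Tr F' : nonempty_proper_face S F' ->
  supp T (U F') = supp S (U F') + e * `[< F' `<=` F >]%:R.
Proof.
move=> pF'; have F'U := face_normal_exposed hL hS hfull hsimple pF'.
case: asboolP => [sub|nsub].
  have [x vx u'x] := finite_hull_vertex (U F') Sf.
  have F'x : F' x by rewrite -F'U.
  have [g [d fr]] := vertex_frame_exists hL hS hfull hsimple vx.
  have Fx : F x by exact: sub.
  have [j Fj] := proper_face_facet hS hfull fr pF Fx.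
  rewrite (supp_exposed (exposed_Tr_shift fr Fx Fj pF' F'x (fun=> sub))).
  rewrite (dot_face_normal_shift _ fr)// (supp_exposed u'x) asboolT//.
  exact: subset_trans Fj.
rewrite mulr0 addr0.
(* Maximizing [U F] on [F'] finds a vertex of [F'] outside [F], which survives the truncation. *)
have [e' _ E] := finite_hull_exposed2 (U F') (- U F) Sf.
have [y vy] := finite_hull_vertex (U F' + e' *: - U F) Sf.
rewrite E => -[u'y yP]; have Fy : ~ F y.
  move=> Fy; apply: nsub => p F'p; rewrite -F'U in F'p.
  have uy : exposed S (U F) y by rewrite FU.
  rewrite -FU; apply: (exposedE uy); first exact: exposed_sub F'p.
  apply/le_anti; rewrite uy.2 ?andbT; last exact: exposed_sub F'p.
  by have := yP p F'p; rewrite !dotNl lerN2.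
rewrite (supp_exposed u'y); apply/supp_exposed/(exposedS Tr_sub u'y).
exact: Tr_vertex.
Qed.

Lemma Tr_deformation : deformation L P T.
Proof.
apply: deformation_flag => [|x g d vx fr]; first exact: Tr_finite_hull.
by have [h|[j h]] := Tr_flag_minimized vx fr; [exists x|exists (x + e *: d j)].
Qed.

Lemma Tr_PL : PL (nfan P) (supp T).
Proof.
apply: supp_PL => x g d vx fr.
by have [h|[j h]] := Tr_flag_minimized vx fr; [exists x|exists (x + e *: d j)].
Qed.

End Truncations.

Lemma deformation_self : deformation L P S.
Proof.
apply: deformation_flag => // x g d vx fr; exists x.
apply: (flag_minimized_vertex (d := d)) => //; exact: vertex_in.
Qed.

Lemma PL_self : PL (nfan P) (supp S).
Proof.
apply: supp_PL => // x g d vx fr; exists x.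
apply: (flag_minimized_vertex (d := d)) => //; exact: vertex_in.
Qed.

End Deformations.

(** * Delzant polytopes *)
Section Spans.

Lemma lspan_fin (R : realType) (M : lmodType R) (A : set M) (I : finType)
  (g : I -> M) (c : I -> R) : (forall i, A (g i)) -> lspan A (\sum_i c i *:
    g i).
Proof.
move=> gA; exists #|I|, (g \o enum_val), (c \o enum_val); split=> [i|];
  first exact: gA.
exact: (big_enum_val (A := I)).
Qed.

Lemma zspan_fin (M : zmodType) (A : set M) (I : finType) (g : I -> M)
  (c : I -> int) : (forall i, A (g i)) -> zspan A (\sum_i g i *~ c i).
Proof.
move=> gA; exists #|I|, (g \o enum_val), (c \o enum_val); split=> [i|];
  first exact: gA.
exact: (big_enum_val (A := I)).
Qed.

Lemma zspanD (M : zmodType) (A : set M) x y :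
  zspan A x -> zspan A y -> zspan A (x + y).
Proof.
move=> [k [g [c [gA ->]]]] [l [h [e [hA ->]]]].
have := @zspan_fin _ A _ (fun i :
  'I_k + 'I_l => match i with inl i => g i | inr i => h i end)
  (fun i => match i with inl i => c i | inr i => e i end).
by rewrite big_sumType; apply; case.
Qed.

Lemma zspanMz (M : zmodType) (A : set M) x (a : int) :
  zspan A x -> zspan A (x *~ a).
Proof.
move=> [k [g [c [gA ->]]]]; rewrite mulrz_suml.
exists k, g, (fun i => c i * a); split=> //; apply: eq_bigr => i _.
by rewrite mulrzA.
Qed.

Lemma zspan_sum (M : zmodType) (A : set M) (I : Type) (r : seq I) (P :
  pred I) f :
  (forall i, P i -> zspan A (f i)) -> zspan A (\sum_(i <- r | P i) f i).
Proof.
move=> fA; apply: (big_ind (zspan A)) => //; last by move=> x y; exact: zspanD.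
by exists 0%N, (fun=> 0), (fun=> 0); split=> [[]//|]; rewrite big_ord0.
Qed.

Lemma lspanD (R : realType) (M : lmodType R) (A : set M) x y :
  lspan A x -> lspan A y -> lspan A (x + y).
Proof.
move=> [k [g [c [gA ->]]]] [l [h [e [hA ->]]]].
have := @lspan_fin _ _ A _
  (fun i : 'I_k + 'I_l => match i with inl i => g i | inr i => h i end)
  (fun i => match i with inl i => c i | inr i => e i end).
by rewrite big_sumType; apply; case.
Qed.

Lemma lspanZ (R : realType) (M : lmodType R) (A : set M) x (a : R) :
  lspan A x -> lspan A (a *: x).
Proof.
move=> [k [g [c [gA ->]]]]; rewrite scaler_sumr.
exists k, g, (fun i => a * c i); split=> //; apply: eq_bigr => i _.
by rewrite scalerA.
Qed.

Lemma lspan_sub (R : realType) (M : lmodType R) (A : set M) : A `<=` lspan A.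
Proof.
by move=> x Ax; exists 1%N, (fun=> x), (fun=> 1); rewrite big_ord1 scale1r.
Qed.

Lemma lspan_sum (R : realType) (M : lmodType R) (A : set M) (I : Type)
  (r : seq I) (P : pred I) f :
  (forall i, P i -> lspan A (f i)) -> lspan A (\sum_(i <- r | P i) f i).
Proof.
move=> fA; apply: (big_ind (lspan A)) => //; last by move=> x y; exact: lspanD.
by exists 0%N, (fun=> 0), (fun=> 0); split=> [[]//|]; rewrite big_ord0.
Qed.

Lemma lfree_range (R : realType) (M : lmodType R) (I : finType) (h : I -> M) :
  (forall c : I -> R, \sum_i c i *: h i = 0 -> forall i, c i = 0) ->
  lfree (range h).
Proof.
move=> hfree k g c gI gh sum0 i.
have /choice[j hj] i' : exists l, h l = g i' by have [l] := gh i'; exists l.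
have jI : injective j by move=> a b ab; apply: gI; rewrite -!hj ab.
have := hfree (fun l => \sum_(i' | j i' == l) c i') _ (j i).
rewrite (big_pred1 i) => [|i']; last by rewrite /= (inj_eq jI).
apply; rewrite -[RHS]sum0 (partition_big j xpredT)//=; apply: eq_bigr => l _.
by rewrite scaler_suml; apply: eq_bigr => i' /eqP <-; rewrite hj.
Qed.

End Spans.

Section Delzant.
Variables (R : realType) (n : nat) (L S P : set 'rV[R]_n).
Hypotheses (hL : lattice L) (hS : polytope L S) (hfull : full_dim S).
Hypotheses (hsimple : simple S) (hP : omnitruncation L S P).
Local Notation V := 'rV[R]_n.
Local Notation N := (facet_normal L S).
Local Notation U := (face_normal L S).
Implicit Types (u v w x y z : V) (F G Q : set V) (g : 'I_n -> set V).

Let Sf : finite_hull S := polytope_finite_hull hS.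
Let Ssimple : simple_hull S := simple_hullS hL hS hfull hsimple.

Lemma latticeD x y : L x -> L y -> L (x + y).
Proof. by have [B _ ->] := hL; exact: zspanD. Qed.

Lemma latticeMz x (a : int) : L x -> L (x *~ a).
Proof. by have [B _ ->] := hL; exact: zspanMz. Qed.

Lemma latticeB x y : L x -> L y -> L (x - y).
Proof. by move=> Lx Ly; rewrite -mulrN1z; apply/latticeD/latticeMz. Qed.

Lemma facet_normal_lattice G x : facet S G -> L x -> dot (N G) x \is a Num.int.
Proof. by move=> /(facet_normalP hL hS hfull)[_ [+ _ _]] Lx; exact. Qed.

Hypothesis hD : delzant L S.

(* The values of [N (g j)] on [L] are the multiples of its value on the edge
   vector along [d j]; primitivity of [N (g j)] forces that value to be 1. *)
Lemma delzant_frame x g d j : vertex S x -> vertex_frame L S x g d -> L (d j).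
Proof.
move=> vx fr; have [_ _ SL /(_ x vx)[EL Efree]] := hD.
have [_ [Lb b0 bprim]] := facet_normalP hL hS hfull (frame_facet fr j).
have [_ _ Sx] := fr; set b := N (g j) in Lb b0 bprim.
have dir w : edge_vectors L S x w -> exists i t, 0 < t /\ w = t *: d i.
  move=> [_ [y [t [xy t0 ty]]]].
  have [i [t' [t'0 yE]]] := edge_direction Sf Sx xy.
  exists i, (t' / t); split; first exact: divr_gt0.
  have tn0 : t != 0 by rewrite gt_eqF.
  apply: (scalerI tn0); rewrite -ty yE scalerA mulrC divfK//.
  by rewrite addrC addKr.
have bw i t : dot b (t *:
  d i) = t * (j == i)%:R by rewrite dotZr (frame_dual fr).
have [[w [t [Ew t0 wE]]]|H] :=
    pselect (exists w t, [/\ edge_vectors L S x w, 0 < t & w = t *: d j]).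
  have Lw : L w by have [[]] := Ew.
  have bwt : dot b w = t by rewrite wE bw eqxx mulr1.
  have tint : t \is a Num.int by rewrite -bwt; exact: Lb.
  have /natrP[k kE] : t \is a Num.nat by rewrite -intrEge0// ltW.
  (* Two edge vectors along [d j] with integer lengths [t] and [t'] would satisfy an integral
     relation, against freeness. *)
  have uniqw w' : edge_vectors L S x w' -> dot b w' = 0 \/ w' = w.
    move=> Ew'; have [i [t' [t'0 w'E]]] := dir w' Ew'.
    have [ij|ij] := eqVneq j i; last by left; rewrite w'E bw (negPf ij) mulr0.
    right; apply: contrapT => ww'.
    have t'int : t' \is a Num.int.
      have <- : dot b w' = t' by rewrite w'E bw ij eqxx mulr1.
      by apply: Lb; have [[]] := Ew'.
    have /intrP[m mE] := tint; have /intrP[m' m'E] := t'int.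
    have := Efree 2%N (fun i : 'I_2 => if i == ord0 then w else w')
      (fun i : 'I_2 => if i == ord0 then m' else - m) _ _ _ ord0.
    rewrite /= => m'0; have : t' = 0; last by move=> t'_eq;
      rewrite t'_eq ltxx in t'0.
    rewrite m'E m'0//.
    - by move=> [[|[|//]] ?] [[|[|//]] ?] //= h; try (exact: val_inj);
         case: ww'; rewrite h.
    - by move=> i'; case: ifP.
    - rewrite big_ord_recl big_ord1 /= mulrNz -[w *~ _]scaler_int.
      rewrite -[w' *~ _]scaler_int -mE -m'E.
      by rewrite wE w'E ij !scalerA mulrC subrr.
  have Lv : dual_lattice L (t^-1 *: b).
    move=> p; rewrite -EL => -[k' [p' [c [Ep ->]]]].
    rewrite dot_sumr rpred_sum// => i _;
      rewrite -scaler_int dotZr rpredM ?intr_int//.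
    rewrite dotZl; have [->|->] := uniqw _ (Ep i);
      first by rewrite mulr0 rpred0.
    by rewrite bwt mulVf ?rpred1// gt_eqF.
  have k1 : k = 1%N.
    apply: bprim Lv _; rewrite -scaler_nat -kE scalerA divff ?scale1r//.
    by rewrite gt_eqF.
  by move: Lw; rewrite wE kE k1 scale1r.
(* Without an edge vector along [d j], [b] vanishes on [L], so even its half is in the dual
   lattice. *)
have Lv : dual_lattice L (2^-1 *: b).
  move=> p; rewrite -EL => -[k' [p' [c [Ep ->]]]].
  rewrite dot_sumr rpred_sum// => i _;
    rewrite -scaler_int dotZr rpredM ?intr_int//.
  rewrite dotZl; have [i' [t [t0 wE]]] := dir _ (Ep i).
  have [ij|ij] := eqVneq j i'; last by rewrite wE bw (negPf ij) !mulr0 rpred0.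
  by case: H; exists (p' i), t; rewrite ij.
by have := bprim _ 2%N Lv;
  rewrite -scaler_nat scalerA divff ?scale1r ?pnatr_eq0// => /(_ erefl).
Qed.

Lemma delzant_edge F x y :
  nonempty_proper_face S F -> vertex S x -> vertex S y ->
  F x -> ~ F y -> edge S x y -> exists2 k : nat, (0 < k)%N &
    dot (U F) y = supp S (U F) + k%:R /\
    (primitive_delzant L S -> k = 1%N).
Proof.
move=> pF vx vy Fx Fy xy;
  have [g [d fr]] := vertex_frame_exists hL hS hfull hsimple vx.
have [_ _ Sx] := fr; have [_ _ SL _] := hD.
have [j [t [t0 yE]]] := edge_direction Sf Sx xy.
have FU := face_normal_exposed hL hS hfull hsimple pF.
have ux : exposed S (U F) x by rewrite FU.
have uy : dot (U F) y = supp S (U F) + t * `[< F `<=` g j >]%:R.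
  by rewrite yE !dotE (face_normal_dual fr _ Fx) (supp_exposed ux).
have Fj : F `<=` g j.
  apply: contrapT => Fj; apply: Fy; rewrite -FU; apply: (exposedE ux).
    exact: vertex_in.
  by rewrite uy (asboolF Fj) mulr0 addr0 (supp_exposed ux).
rewrite (asboolT Fj) mulr1 in uy.
have bt : dot (N (g j)) (y - x) = t.
  by rewrite yE [x + _]addrC addrK dotZr (frame_dual fr) eqxx mulr1.
have : t \is a Num.int.
  by rewrite -bt; apply: facet_normal_lattice;
    [exact: frame_facet fr j|apply: latticeB; exact: SL].
rewrite intrEge0 ?(ltW t0)// => /natrP[k kE].
exists k; first by rewrite -(ltr_nat R) -kE.
split; first by rewrite -kE.
have dj0 : d j <> 0.
  by move=> dj0; have := frame_dual fr j j; rewrite dj0 dot0r eqxx => /eqP;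
    rewrite eq_sym oner_eq0.
move=> [_ /(_ x y xy) xyL].
have k1 : 1 <= t by rewrite kE -[1]/(1%:R) ler_nat -(ltr_nat R) -kE.
(* As [d j] is a lattice vector and [1 <= t], this is a lattice point on the edge other than [x];
   primitivity makes it [y]. *)
have : (L `&` hull [set x; y]) (x + d j).
  split; first by apply: latticeD; [exact: SL|exact: delzant_frame fr].
  apply/hull2; exists t^-1; first by rewrite invr_ge0 ltW//= invf_le1.
  by rewrite yE [x + t *: _]addrC addrK scalerA mulVf ?scale1r// gt_eqF.
rewrite xyL => -[/eqP|].
  by rewrite addrC -subr_eq0 addrK => /eqP.
rewrite yE => /addrI dE; have := frame_dual fr j j.
rewrite {1}dE dotZr (frame_dual fr) eqxx mulr1 kE => /eqP.
by rewrite -[X in _ == X]/(1%:R) eqr_nat => /eqP.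
Qed.

Lemma delta_delzant F : nonempty_proper_face S F -> exists2 k : nat, (0 < k)%N &
  delta L S F = k%:R /\ (primitive_delzant L S -> k = 1%N).
Proof.
move=> pF; have FU := face_normal_exposed hL hS hfull hsimple pF.
have [q vq Fq] := vertex_notin hL hS hfull hsimple pF.
have [|y [[vy Fy [x [vx Fx xy]]] dE _]] := depth_attained (u :=
  U F) Ssimple (vertex_in vq).
  by rewrite FU.
rewrite FU in dE Fx Fy.
have [k k0 [kE k1]] := delzant_edge pF vx vy Fx Fy xy.
by exists k => //; split=> //; rewrite /delta dE kE addrC addKr.
Qed.

Lemma delzant_delta_ge1 F : nonempty_proper_face S F -> 1 <= delta L S F.
Proof. by move=> /delta_delzant[k k0 [-> _]]; rewrite -[1]/(1%:R) ler_nat. Qed.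

Lemma supp_facet_int G : facet S G -> supp S (N G) \is a Num.int.
Proof.
move=> fG; have [z vz Gz] := finite_hull_vertex (N G) Sf.
rewrite (supp_exposed Gz); apply: facet_normal_lattice => //.
by have [_ _ SL _] := hD; exact: SL.
Qed.

Lemma PLint_Tr F : nonempty_proper_face S F ->
  PLint L (nfan P) (supp (Tr L S F 1)).
Proof.
move=> pF sigma /(nfan_flag hL hS hfull hsimple hP)[x [g [d [vx fr H]]]].
have Lx : L x by have [_ _ SL _] := hD; exact: SL.
have [h|[j h]] := Tr_flag_minimized hL hS hfull hsimple pF ltr01
  (delzant_delta_ge1 pF) vx fr.
  by exists x => // u su; exact/supp_exposed/(H _ _ u h su).
exists (x + 1 *: d j) => [|u su]; last exact/supp_exposed/(H _ _ u h su).
by rewrite scale1r; apply: latticeD => //; exact: delzant_frame fr.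
Qed.

Lemma PLint_self : PLint L (nfan P) (supp S).
Proof.
move=> sigma /(nfan_flag hL hS hfull hsimple hP)[x [g [d [vx fr H]]]].
exists x => [|u su]; first by have [_ _ SL _] := hD; exact: SL.
apply/supp_exposed/(H _ _ u _ su);
  apply: (flag_minimized_vertex hL hS hfull fr) => //.
exact: vertex_in.
Qed.

(** A cut at depth 1 creates no vertices: an edge crossing it strictly would start in [F] and end at
    height exactly 1. So a functional separating a point from the hull is minimized on the
    truncation at an old vertex. *)
Lemma primitive_delzant_flat F : primitive_delzant L S ->
  nonempty_proper_face S F -> flat L S F.
Proof.
move=> hD1 pF; have FU := face_normal_exposed hL hS hfull hsimple pF.
have [k _ [dE /(_ hD1) k1]] := delta_delzant pF.
have d1 : delta L S F = 1 by rewrite dE k1.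
rewrite /flat /DTr d1; have TE := @TrE _ _ L S F 1 pF.
have [r rP] := finite_hull_vertices Sf.
pose r' := [seq z <- r | `[< ~ F z >]].
have r'E : [set x | vertex S x /\ ~ F x] = [set` r'].
  apply/seteqP; split=> z /=; rewrite mem_filter.
    by move=> [/(rP z).2 -> Fz]; rewrite andbT; exact/asboolP.
  by move=> /andP[/asboolP Fz /(rP z).1].
apply/seteqP; split; last first.
  apply: hull_least; first by rewrite TE; apply: convex_cut;
    exact: finite_hull_convex.
  by move=> z [vz Fz]; apply: (Tr_vertex hL hS hfull hsimple pF); rewrite ?d1.
move=> x Tx; apply: contrapT; rewrite r'E => /hull_separation[v vx].
have Tf : finite_hull (Tr L S F 1).
  by apply: (Tr_finite_hull hL hS hfull hsimple pF); rewrite ?d1.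
have [z vz [Tz /(_ x Tx)]] := finite_hull_vertex v Tf.
apply/negP; rewrite -ltNge; apply: vx; rewrite mem_filter.
suff [vSz Fz] : vertex S z /\ ~ F z by apply/andP; split;
  [exact/asboolP|exact/rP].
have Scx := finite_hull_convex Sf.
rewrite TE in vz Tz; have [Sz /= cz] := Tz.
have notF y : supp S (U F) + 1 <= dot (U F) y -> ~ F y.
  by move=> cy; rewrite -FU => /supp_exposed E; rewrite E gerDl ler10 in cy.
split; last exact: notF.
have [cz'|zc] := ltP (supp S (U F) + 1) (dot (U F) z).
  exact: vertex_cut_interior vz cz'.
have zc' : dot (U F) z = supp S (U F) + 1 by apply/le_anti; rewrite zc cz.
apply: contrapT => nz.
have [a [b [ab va vb /andP[ac cb] _]]] := vertex_cut_boundary Sf vz zc' nz.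
have Fa : F a.
  apply: contrapT => Fa; have := delta_le_vertex hL hS hfull hsimple pF va Fa.
  by rewrite d1 lerBrDl leNgt ac.
have [k' _ [bE /(_ hD1) k'1]] := delzant_edge pF va vb Fa (notF b (ltW cb)) ab.
by move: cb; rewrite bE k'1 ltxx.
Qed.

End Delzant.

(** * Spans of support functions *)
Lemma zeta_unitmx (K : comUnitRingType) m (z : rel 'I_m) :
  (forall i j, z i j -> (i <= j)%N) -> (forall i, z i i) ->
  (\matrix_(i, j) (z i j)%:R : 'M[K]_m) \in unitmx.
Proof.
move=> zle zz; rewrite unitmxE -det_tr det_trig; last first.
  apply/is_trig_mxP => i j ij; rewrite !mxE; case: (boolP (z j i)) => // /zle.
  by rewrite leqNgt ij.
by rewrite big1 ?unitr1// => i _; rewrite !mxE zz.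
Qed.

(** The general ring serves both real and integral spans: a unitriangular matrix is invertible over
    the integers as well. *)
Lemma zeta_solve (K : comUnitRingType) m (z : rel 'I_m) (a : 'I_m -> K) :
  (forall i j, z i j -> (i <= j)%N) -> (forall i, z i i) ->
  exists c, forall i, \sum_j c j * (z i j)%:R = a i.
Proof.
move=> zle zz; have Zu := zeta_unitmx K zle zz; set Z := \matrix_(i, j) _ in Zu.
exists (fun j => (invmx Z *m \col_i a i) j 0) => i.
have /matrixP/(_ i 0) :
  Z *m (invmx Z *m \col_i a i) = \col_i a i by rewrite mulKVmx.
by rewrite mxE [RHS]mxE => <-; apply: eq_bigr => j _; rewrite [Z _ _]mxE mulrC.
Qed.

Lemma zeta_inj (K : comUnitRingType) m (z : rel 'I_m) (c : 'I_m -> K) :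
  (forall i j, z i j -> (i <= j)%N) -> (forall i, z i i) ->
  (forall i, \sum_j c j * (z i j)%:R = 0) -> forall j, c j = 0.
Proof.
move=> zle zz c0 j; have Zu := zeta_unitmx K zle zz;
  set Z := \matrix_(i, j) _ in Zu.
have /(congr1 (mulmx (invmx Z))) : Z *m \col_i c i = 0.
  apply/colP => i; rewrite !mxE -[RHS](c0 i); apply: eq_bigr => k _.
  by rewrite !mxE mulrC.
by rewrite mulKmx// mulmx0 => /colP/(_ j); rewrite !mxE.
Qed.

Section PiecewiseLinear.
Variables (R : realType) (n : nat) (L : set 'rV[R]_n) (Psi :
  set (set 'rV[R]_n)).

Lemma PL_comb (k : nat) (f : 'I_k -> 'rV[R]_n -> R) (c : 'I_k -> R) :
  (forall i, PL Psi (f i)) -> PL Psi (\sum_i c i *: f i).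
Proof.
move=> fP sigma sP.
have /choice[x xP] i :
  exists x, forall u, sigma u -> f i u = dot u x by exact: fP.
exists (\sum_i c i *: x i) => u su; rewrite fct_sumE dot_sumr.
by apply: eq_bigr => i _; rewrite dotZr -xP.
Qed.

Lemma PLint_comb (k : nat) (f : 'I_k -> 'rV[R]_n -> R) (c : 'I_k -> int) :
  lattice L -> (forall i, PLint L Psi (f i)) -> PLint L Psi (\sum_i f i *~ c i).
Proof.
move=> hL fP sigma sP.
have /choice[x xP] i : exists x, L x /\ forall u, sigma u -> f i u = dot u x.
  by have [x Lx H] := fP i sigma sP; exists x.
exists (\sum_i x i *~ c i) => [|u su].
  have [B _ LE] := hL; rewrite LE; apply: zspan_sum => i _; apply: zspanMz.
  by rewrite -LE; case: (xP i).
rewrite fct_sumE dot_sumr; apply: eq_bigr => i _.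
have [_ /(_ u su) fx] := xP i.
by rewrite -[x i *~ _]scaler_int dotZr -fx -[f i *~ _]scaler_int.
Qed.

Lemma lspan_PL (A : set ('rV[R]_n -> R)) : A `<=` PL Psi -> lspan A `<=` PL Psi.
Proof. by move=> AP _ [k [g [c [gA ->]]]]; apply: PL_comb => i; exact: AP. Qed.

Lemma zspan_PLint (A : set ('rV[R]_n -> R)) : lattice L -> A `<=` PLint L Psi ->
  zspan A `<=` PLint L Psi.
Proof. by move=> hL AP _ [k [g [c [gA ->]]]]; apply: PLint_comb => // i;
  exact: AP. Qed.

Lemma PLint_PL : PLint L Psi `<=` PL Psi.
Proof. by move=> f fP sigma /fP[x _ xP]; exists x. Qed.

End PiecewiseLinear.

(** * Spans, bases and integral spans of truncations *)

Section Spanning.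
Variables (R : realType) (n : nat) (L S P : set 'rV[R]_n).
Hypotheses (hL : lattice L) (hS : polytope L S) (hfull : full_dim S).
Hypotheses (hsimple : simple S) (hP : omnitruncation L S P).
Variable fs : seq (set 'rV[R]_n).
Hypothesis hfs : face_listing S fs.
Local Notation V := 'rV[R]_n.
Local Notation N := (facet_normal L S).
Local Notation U := (face_normal L S).
Local Notation m := (size fs).
Implicit Types (u v w x y z : V) (F G Q : set V).

Let Sf : finite_hull S := polytope_finite_hull hS.
Let face_of (i : 'I_m) := nth set0 fs i.
Let zeta (i j : 'I_m) := `[< face_of i `<=` face_of j >].

Lemma face_ofP i : nonempty_proper_face S (face_of i).
Proof. by have [_ fsP _] := hfs; apply/fsP; exact: mem_nth. Qed.

Lemma face_of_surj F : nonempty_proper_face S F -> exists i, face_of i = F.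
Proof.
have [_ fsP _] := hfs; move=> /fsP Ff;
  have i_m : (index F fs < m)%N by rewrite index_mem.
by exists (Ordinal i_m); exact: nth_index.
Qed.

Lemma zeta_le i j : zeta i j -> (i <= j)%N.
Proof. by have [_ _ fsI] := hfs; move=> /asboolP; exact: fsI. Qed.

Lemma zeta_refl i : zeta i i. Proof. exact/asboolP. Qed.

Lemma proper_faceE : proper_face S = [set F | F = set0 \/ nonempty_proper_face
  S F].
Proof.
apply/seteqP; split=> F /=.
  by move=> pF; have [->|/set0P F0] := eqVneq F set0; [left|right].
move=> [->|[]//]; split; first by left.
split=> // S0; have [z /vertex_in /S0] := finite_hull_vertex 0 Sf; exact.
Qed.

Lemma Tr_set0 (e : R) : Tr L S set0 e = S.
Proof. by rewrite /Tr asboolT. Qed.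

Section Depths.
(** The depth may depend on the face, so that [delta] and constant depths are treated together. *)
Variable e : set V -> R.
Hypotheses (e0 : forall F, nonempty_proper_face S F -> 0 < e F)
  (ed : forall F, nonempty_proper_face S F -> e F <= delta L S F).

Let h i := supp (Tr L S (face_of i) (e (face_of i))).

Lemma suppTr_PL i : PL (nfan P) (h i).
Proof.
exact: (Tr_PL hL hS hfull hsimple hP (face_ofP i) (e0 (face_ofP i))
  (ed (face_ofP i))).
Qed.

Lemma suppTrE i j : h j (U (face_of i)) =
  supp S (U (face_of i)) + e (face_of j) * (zeta i j)%:R.
Proof.
exact: (supp_Tr hL hS hfull hsimple (face_ofP j) (e0 (face_ofP j))
  (ed (face_ofP j)) (face_ofP i)).
Qed.

Lemma Tr_deformations Q : [set Tr L S F (e F) | F in proper_face S] Q ->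
  deformation L P Q.
Proof.
rewrite proper_faceE => -[F [->|pF] <-]; last first.
  by apply: Tr_deformation => //; [exact: e0|exact: ed].
by rewrite Tr_set0; exact: deformation_self.
Qed.

Lemma supp_TrS i : (@supp R n @` [set Tr L S F (e F) | F in proper_face S]) (h
  i).
Proof.
exists (Tr L S (face_of i) (e (face_of i))) => //; exists (face_of i) => //.
by case: (face_ofP i).
Qed.

Lemma supp_selfS : (@supp R n @` [set Tr L S F (e F) | F in proper_face S])
  (supp S).
Proof.
by exists S => //; exists set0; rewrite ?Tr_set0// proper_faceE; left.
Qed.

Lemma supp_Tr_sub (T : set (V -> R)) : T (supp S) ->
  (forall F, nonempty_proper_face S F -> T (supp (Tr L S F (e F)))) ->
  @supp R n @` [set Tr L S F (e F) | F in proper_face S] `<=` T.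
Proof.
by move=> TS TT _ [_ [F + <-] <-]; rewrite proper_faceE => -[->|/TT//];
  rewrite Tr_set0.
Qed.

Lemma Tr_generating :
  generating_set L P [set Tr L S F (e F) | F in proper_face S].
Proof.
split; first exact: Tr_deformations.
set A := @supp R n @` _; have PLS := PL_self hL hS hfull hsimple hP.
have AP : A `<=` PL (nfan P).
  apply: supp_Tr_sub => // F pF.
  by apply: Tr_PL => //; [exact: e0|exact: ed].
apply/seteqP; split; first exact: lspan_PL.
move=> f fP; have [c cP] :=
  zeta_solve (fun i => f (U (face_of i))) zeta_le zeta_refl.
pose b i := c i / e (face_of i).
have eN0 i : e (face_of i) != 0 by rewrite gt_eqF// e0//; exact: face_ofP.
have bA : lspan A (\sum_i (b i *: h i + - b i *: supp S)).
  apply: lspan_sum => i _; apply: lspanD; apply: lspanZ; apply: lspan_sub.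
    exact: supp_TrS.
  exact: supp_selfS.
suff -> : f = \sum_i (b i *: h i + - b i *: supp S) by [].
apply: (PL_eq hL hS hfull hsimple hP fP); first exact: (lspan_PL AP).
move=> _ /face_of_surj[i <-]; rewrite fct_sumE -cP; apply: eq_bigr => j _.
rewrite /= -[RHS]/(b j * h j (U (face_of i)) + - b j * supp S (U (face_of i))).
rewrite suppTrE /b; field; exact: eN0.
Qed.

End Depths.

Let t (i : 'I_m) := if `[< facet S (face_of i) >] then supp S (N (face_of i))
  else 0.

Lemma supp_face_normal i : supp S (U (face_of i)) = \sum_j t j * (zeta i j)%:R.
Proof.
have pF := face_ofP i; have FU := face_normal_exposed hL hS hfull hsimple pF.
have [[_ _] [x Fx]] := pF.
have ux : exposed S (U (face_of i)) x by rewrite FU.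
have [fsU fsP _] := hfs.
rewrite (supp_exposed ux) /face_normal.
set p := fun G => `[< facet S G >] && `[< face_of i `<=` G >].
have -> : [set G | facet S G /\ face_of i `<=` G] = [set` [seq G <- fs | p G]].
  apply/seteqP; split=> G /=; rewrite mem_filter /p.
    move=> [fG FG]; rewrite (asboolT fG) (asboolT FG) /=.
    by apply/fsP; case: fG.
  by move=> /andP[/andP[/asboolP ? /asboolP ?] _].
rewrite -fsbig_seq ?filter_uniq// big_filter dot_suml (big_nth set0) big_mkord.
rewrite big_mkcond/=; apply: eq_bigr => j _; rewrite /p /t /zeta /face_of.
case: asboolP => [fG|]; last by rewrite mul0r.
case: asboolP => [FG|]; last by rewrite mulr0.
rewrite mulr1; apply/esym/supp_exposed.
by rewrite (facet_normal_exposed hL hS hfull fG); exact: FG.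
Qed.

(* On the face normals, the support functions form the matrix of [zeta] scaled
   by [e] plus a rank one matrix; as [supp S] is the [zeta]-transform of [t],
   that matrix is invertible as soon as [e + \sum_i t i <> 0]. *)
Lemma Tr_basis (e : R) : 0 < e ->
  (forall F, nonempty_proper_face S F -> e <= delta L S F) ->
  e + \sum_i t i != 0 ->
  basis L P [set Tr L S F e | F in nonempty_proper_face S].
Proof.
move=> e0 ed et; set A := [set _ | _ in _].
pose h i := supp (Tr L S (face_of i) e).
have hPL i : PL (nfan P) (h i) by exact: (suppTr_PL (e := fun=> e)).
have hE i j : h j (U (face_of i)) = supp S (U (face_of i)) + e * (zeta i j)%:R.
  exact: (suppTrE (e := fun=> e)).
have AE : @supp R n @` A = range h.
  apply/seteqP; split=> [_ [_ [F pF <-] <-]|_ [i _ <-]].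
    by have [i iF] := face_of_surj pF; exists i => //; rewrite /h iF.
  exists (Tr L S (face_of i) e) => //; exists (face_of i) => //;
    exact: face_ofP.
have hsum (c : 'I_m -> R) i : (\sum_j c j *: h j) (U (face_of i)) =
    \sum_j (e * c j + (\sum_k c k) * t j) * (zeta i j)%:R.
  rewrite fct_sumE (eq_bigr (fun j =>
    c j * supp S (U (face_of i)) + e * c j * (zeta i j)%:R)); last first.
    move=> j _; rewrite -[LHS]/(c j * h j (U (face_of i))) hE; ring.
  rewrite big_split/= -mulr_suml supp_face_normal mulr_sumr -big_split/=.
  by apply: eq_bigr => j _; ring.
have e_neq0 : e != 0 by rewrite gt_eqF.
rewrite /basis /generating_set AE; split; first split.
- move=> _ [F pF <-]; apply: Tr_deformation => //; exact: ed.
- have hA : range h `<=` PL (nfan P) by move=> _ [i _ <-].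
  apply/seteqP; split; first exact: lspan_PL.
  move=> f fP; have [c cP] :=
    zeta_solve (fun i => f (U (face_of i))) zeta_le zeta_refl.
  (* Solves [e * b i + C * t i = c i] with [C] the sum of the [b i]; summing these equations over
     [i] determines [C]. *)
  pose C := (\sum_i c i) / (e + \sum_i t i); pose b i := (c i - C * t i) / e.
  have bC : \sum_i b i = C.
    rewrite /b -mulr_suml sumrB -mulr_sumr; apply: (mulIf e_neq0).
    rewrite divfK//; have : C * (e + \sum_i t i) = \sum_i c i by rewrite divfK.
    by move=> <-; ring.
  suff -> : f = \sum_i b i *: h i by apply: lspan_fin => i; exists i.
  apply: (PL_eq hL hS hfull hsimple hP fP); first exact: PL_comb.
  move=> _ /face_of_surj[i <-]; rewrite hsum bC -cP; apply: eq_bigr => j _.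
  by congr (_ * _); rewrite /b mulrC divfK// subrK.
- apply: lfree_range => c c0.
  have b0 : forall j, e * c j + (\sum_k c k) * t j = 0.
    by apply: (zeta_inj zeta_le zeta_refl) => i; rewrite -hsum c0.
  have : \sum_j (e * c j + (\sum_k c k) * t j) = 0 by rewrite big1.
  rewrite big_split/= -!mulr_sumr mulrC -mulrDr => /eqP.
  rewrite mulf_eq0 (negPf et) orbF => /eqP C0 j.
  move: (b0 j) => /eqP;
    rewrite C0 mul0r addr0 mulf_eq0 (negPf e_neq0) => /eqP//.
Qed.

Lemma delta_gt0 F : nonempty_proper_face S F -> 0 < delta L S F.
Proof.
move=> pF; have FU := face_normal_exposed hL hS hfull hsimple pF.
have [q vq Fq] := vertex_notin hL hS hfull hsimple pF.
rewrite /delta -{1}FU; apply: (depth_gt0 (simple_hullS hL hS hfull hsimple)).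
  exact: vertex_in vq.
by rewrite FU.
Qed.

Lemma shallow_basis : exists2 eps0 : R, 0 < eps0 & forall eps :
  R, 0 < eps < eps0 ->
  (forall F, nonempty_proper_face S F -> shallow S F (U F) eps) /\
  basis L P [set Tr L S F eps | F in nonempty_proper_face S].
Proof.
have [d d0 dP] := seq_small (delta L S) (fun=> 1) fs.
have [_ fsP _] := hfs; pose s := \sum_i t i.
have dlt F : nonempty_proper_face S F -> d < delta L S F.
  by move=> pF; have := dP F; rewrite mulr1; apply;
    [exact/fsP|exact: delta_gt0].
(* Below [d] every truncation is shallow. Below the absolute value of [s] the sum [eps + s] cannot
   vanish; for [s = 0] any positive bound will do. *)
exists (Num.min d (if s == 0 then 1 else `|s|)).
  by rewrite lt_min d0; case: eqVneq => [_|s0]; rewrite ?ltr01// normr_gt0.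
move=> eps /andP[eps0]; rewrite lt_min => /andP[eps_d eps_s].
have epsd F : nonempty_proper_face S F -> eps < delta L S F.
  by move=> /dlt; exact: lt_trans.
split=> [F pF|]; first by rewrite /shallow eps0 epsd.
apply: Tr_basis => // [F /epsd/ltW//|]; rewrite -/s; apply/eqP => es.
move: eps_s; have -> : s = - eps by apply/eqP; rewrite -addr_eq0 addrC es.
by rewrite oppr_eq0 gt_eqF// normrN gtr0_norm// ltxx.
Qed.

Hypothesis hD : delzant L S.

Lemma unit_integral_generating :
  integral_generating_set L P [set Tr L S F 1 | F in proper_face S].
Proof.
have d1 := delzant_delta_ge1 hL hS hfull hsimple hD.
have e0 F : nonempty_proper_face S F -> 0 < 1 :> R by [].
split; first exact: (Tr_generating (e := fun=> 1)).
set A := @supp R n @` _.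
have AP : A `<=` PLint L (nfan P).
  apply: (supp_Tr_sub (e := fun=> 1)); first exact: PLint_self.
  by move=> F pF; exact: PLint_Tr.
apply/seteqP; split; first exact: zspan_PLint.
move=> f fP; pose h i := supp (Tr L S (face_of i) 1).
have hE i j : h j (U (face_of i)) = supp S (U (face_of i)) + 1 * (zeta i j)%:R.
  exact: (suppTrE (e := fun=> 1) e0 d1).
(* Face normals are in the dual lattice, so an integral [f] takes integer values there and the
   unitriangular system is solved over [int]. *)
have fint i : f (U (face_of i)) \is a Num.int.
  have [fan uu] := nfan_cover hL hS hfull hsimple hP (U (face_of i)).
  have [x Lx ->//] := fP _ fan.
  exact: (face_normal_dual_lattice hL hS hfull hP).
have /choice[a aE] i : exists a : int, f (U (face_of i)) = a%:~R by apply/intrP.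
have [c cP] := zeta_solve a zeta_le zeta_refl.
have cA : zspan A (\sum_i (h i *~ c i + supp S *~ - c i)).
  apply: zspan_sum => i _; apply: zspanD; apply: zspanMz; apply: zspan_sub.
    exact: (supp_TrS (fun=> 1) i).
  exact: (supp_selfS (fun=> 1)).
suff -> : f = \sum_i (h i *~ c i + supp S *~ - c i) by [].
apply: (PL_eq hL hS hfull hsimple hP); first exact: PLint_PL fP.
  by apply: (@PLint_PL _ _ L); exact: zspan_PLint cA.
move=> _ /face_of_surj[i <-]; rewrite fct_sumE aE -cP rmorph_sum/=.
apply: eq_bigr => j _; rewrite rmorphM/= rmorph_nat.
rewrite -[h j *~ _]scaler_int -[supp S *~ _]scaler_int.
rewrite -[RHS]/((c j)%:~R * h j (U (face_of i)) + (- c j)%:~R * supp S (U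
  (face_of i))).
by rewrite hE rmorphN/=; ring.
Qed.

Hypothesis h0 : interior S 0.

Lemma supp_facet_le G : facet S G -> supp S (N G) <= -1.
Proof.
move=> fG; have [_ [_ N0 _]] := facet_normalP hL hS hfull fG.
have [z vz Gz] := finite_hull_vertex (N G) Sf.
have [r r0 Sr] := interior_direction (- N G) h0.
have sneg : supp S (N G) < 0.
  rewrite (supp_exposed Gz); apply: le_lt_trans (Gz.2 _ Sr) _.
  rewrite add0r scalerN dotNr dotZr oppr_lt0 mulr_gt0// dot_gt0//.
  exact/eqP.
have := norm_intr_ge1 (supp_facet_int hL hS hfull hD fG).
by rewrite lt_eqF// ltr0_norm// lerNr; apply.
Qed.

(** The second facet contains the face exposed by [- N G1]; were it [G1], the functional [N G1]
    would be constant on [S]. *)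
Lemma two_facets F : nonempty_proper_face S F ->
  exists G1 G2, [/\ facet S G1, facet S G2 & G1 <> G2].
Proof.
move=> /(face_normal_neq0 hL hS hfull hsimple) U0.
have [G1 fG1 _] := exposed_sub_facet Sf hfull U0.
have [G1E [_ N0 _]] := facet_normalP hL hS hfull fG1.
have N0' : - N G1 <> 0 by move=> /eqP; rewrite oppr_eq0 => /eqP.
have [G2 fG2 G2P] := exposed_sub_facet Sf hfull N0'.
exists G1, G2; split=> // G12; apply: N0;
  apply: (full_dim_exposed hfull) => y Sy.
have [z _ Nz] := finite_hull_vertex (- N G1) Sf.
have := G2P z Nz; rewrite -G12 -{1}G1E => Nz'.
apply: (exposedE Nz') => //; apply/le_anti; rewrite (Nz'.2 _ Sy) andbT.
by have := Nz.2 _ Sy; rewrite !dotNl lerN2.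
Qed.

Lemma sum_t_neq : 1 + \sum_i t i != 0.
Proof.
have t_le0 i : t i <= 0.
  by rewrite /t; case: asboolP => // /supp_facet_le; lra.
(* Without nonempty proper faces the sum is empty and the value is 1; otherwise two facets bring it
   down to at most -1. *)
have [i0|H] := pselect (exists i : 'I_m, True); last first.
  by rewrite big1 ?addr0 ?oner_eq0// => i _; case: H; exists i.
have [i _] := i0.
have [G1 [G2 [fG1 fG2 G12]]] := two_facets (face_ofP i).
have [i1 i1E] := face_of_surj fG1.1; have [i2 i2E] := face_of_surj fG2.1.
have t1 : t i1 <= -1 by rewrite /t i1E (asboolT fG1); exact: supp_facet_le.
have t2 : t i2 <= -1 by rewrite /t i2E (asboolT fG2); exact: supp_facet_le.
have i12 : i2 != i1 by apply/eqP => i12; apply: G12; rewrite -i1E -i2E i12.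
rewrite (bigD1 i1)//= (bigD1 i2)//=.
have : \sum_(j | (j != i1) && (j != i2)) t j <= 0 by apply: sumr_le0.
by move=> h; rewrite lt_eqF//; lra.
Qed.

End Spanning.

Theorem theorem4p35 (R : realType) (n : nat) (L S P : set 'rV[R]_n)
  (hL : lattice L) (hS : polytope L S) (hfull : full_dim S) (hsimple : simple S)
  (h0 : interior S 0) (hP : omnitruncation L S P) :
  [/\ exists2 eps0 : R, 0 < eps0 & forall eps : R, 0 < eps < eps0 ->
        (forall F, nonempty_proper_face S F ->
           shallow S F (face_normal L S F) eps) /\
        basis L P [set Tr L S F eps | F in nonempty_proper_face S],
      generating_set L P [set DTr L S F | F in proper_face S],
      delzant L S ->
        integral_generating_set L P [set Tr L S F 1 | F in proper_face S] &
      primitive_delzant L S ->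
        [/\ [set DTr L S F | F in nonempty_proper_face S] =
              [set Tr L S F 1 | F in nonempty_proper_face S],
            forall F, nonempty_proper_face S F -> flat L S F &
            basis L P [set DTr L S F | F in nonempty_proper_face S]]].
Proof.
have [fs [_ [hfs _ _]]] := hP; split.
- exact: (shallow_basis hL hS hfull hsimple hP hfs).
- apply: (Tr_generating hL hS hfull hsimple hP hfs (e := delta L S)) => //.
  exact: (delta_gt0 hL hS hfull hsimple).
- exact: (unit_integral_generating hL hS hfull hsimple hP hfs).
move=> hD1; have hD := hD1.1.
have d1 F : nonempty_proper_face S F -> delta L S F = 1.
  by move=> /(delta_delzant hL hS hfull hsimple hD)[k _ [-> /(_ hD1) ->]].
have E : [set DTr L S F | F in nonempty_proper_face S] =
    [set Tr L S F 1 | F in nonempty_proper_face S].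
  by apply: eq_imagel => F pF; rewrite /DTr d1.
rewrite E; split=> // [F|].
  exact: (primitive_delzant_flat hL hS hfull hsimple hD).
apply: (Tr_basis hL hS hfull hsimple hP hfs) => //.
  by move=> F /d1 ->.
exact: (sum_t_neq hL hS hfull hsimple hfs hD h0).
Qed.
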